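(* Let $p$ be an odd integer with $p \geq 3$, let $n$ be a non-negative integer and let $r$ be an integer with $1 \leq r \leq p-1$, $\gcd(p,r)=1$ and $np+r \geq 2$. Then $$u(W(p,np+r)) \leq \frac{n(p^2-1)}{4}+\frac{(p-1)r}{2}-1.$$
   Context: For positive integers $p,q$, let $B_W(p,q)$ be the braid on $p$ strands represented by $\left( \sigma_1 \sigma_2^{-1} \sigma_3 \cdots \sigma_{p-1}^{(-1)^p}\right)^q$, where $\sigma_i$ are the standard Artin generators (so $\sigma_i$ appears with exponent $(-1)^{i+1}$). For coprime integers $p \geq 3$ and $q \geq 2$, the weaving knot $W(p,q)$ is the closure of $B_W(p,q)$; it is an alternating knot. The unknotting number $u(K)$ of a knot $K$ is the minimum number of crossing changes needed to transform $K$ into the trivial knot. *)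

(* Defs.v *)
From mathcomp Require Import all_boot all_order all_algebra.
From mathcomp Require Import all_classical all_reals all_analysis.
Set Implicit Arguments.
Unset Strict Implicit.
Unset Printing Implicit Defensive.
Import Order.TTheory GRing.Theory Num.Theory numFieldNormedType.Exports.
Local Open Scope classical_set_scope.
Local Open Scope ring_scope.

(* Knots live in R^3, whose points are triples ((x, y), z): for u : R3 R,
   u.1 is the projection of u to the xy-plane and u.2 is its height, the
   diagrams being viewed from z = +oo. *)
Notation R3 R := (R * R * R)%type.

Definition homeomorphism (T : topologicalType) (f : T -> T) : Prop :=
  continuous f /\ exists g : T -> T, [/\ continuous g, cancel f g & cancel g f].

Definition ambient_isotopic (R : realType) (K L : set (R3 R)) : Prop :=
  exists H : R -> R3 R -> R3 R,
    [/\ {within [set u : R * R3 R | 0 <= u.1 <= 1],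
           continuous (fun u => H u.1 u.2)},
        forall t, 0 <= t <= 1 -> homeomorphism (H t),
        forall x, H 0 x = x
      & H 1 @` K = L].

Definition segment (R : realType) (a b : R3 R) : set (R3 R) :=
  [set x | exists2 t : R, 0 <= t <= 1 & x = (1 - t) *: a + t *: b].

(* A closed polygon is given by its cyclic sequence of vertices v; ordS is the
   cyclic successor on 'I_n, so edge v i joins v i to the next vertex. *)
Definition edge (R : realType) (n : nat) (v : 'I_n -> R3 R) (i : 'I_n) :
    set (R3 R) :=
  segment (v i) (v (ordS i)).

Definition polygon (R : realType) (n : nat) (v : 'I_n -> R3 R) :
    set (R3 R) :=
  [set x | exists i, edge v i x].

Definition polygonal_knot (R : realType) (n : nat) (v : 'I_n -> R3 R) :
    Prop :=
  [/\ (3 <= n)%N, injective v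
    & forall (i j : 'I_n) (x : R3 R), i != j -> edge v i x -> edge v j x ->
        (j = ordS i /\ x = v j) \/ (i = ordS j /\ x = v i)].

(* The first condition forbids a vertex from projecting onto an edge it does not
   belong to; hence multiple points of the projection are transverse. The second
   one forbids triple points. *)
Definition regular_projection (R : realType) (n : nat) (v : 'I_n -> R3 R) :
    Prop :=
  (forall (i j : 'I_n) (x : R3 R),
     j != i -> ordS j != i -> edge v j x -> x.1 <> (v i).1) /\
  (forall (i j k : 'I_n) (x y z : R3 R),
     uniq [:: i; j; k] -> edge v i x -> edge v j y -> edge v k z ->
     ~ (x.1 = y.1 /\ y.1 = z.1)).

Definition passes_over (R : realType) (n : nat) (v : 'I_n -> R3 R)
    (i j : 'I_n) : Prop :=
  exists x y : R3 R,
    [/\ edge v i x, edge v j y, x.1 = y.1 & y.2 < x.2].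

(* The two polygons have the same regular projection and their diagrams differ
   exactly in the over/under information at one crossing. *)
Definition crossing_change (R : realType) (n : nat) (v v' : 'I_n -> R3 R) :
    Prop :=
  [/\ polygonal_knot v, polygonal_knot v', regular_projection v,
      forall i, (v' i).1 = (v i).1
    & exists i j : 'I_n,
        [/\ passes_over v i j, passes_over v' j i
          & forall k l : 'I_n, (k, l) != (i, j) -> (k, l) != (j, i) ->
              (passes_over v' k l <-> passes_over v k l)]].

Definition trivial_knot (R : realType) (K : set (R3 R)) : Prop :=
  exists v : 'I_3 -> R3 R,
    polygonal_knot v /\ ambient_isotopic K (polygon v).

(* The knot may be isotoped, and its diagram thus replaced, before each crossing
   change. *)
Fixpoint unknotted_by (R : realType) (k : nat) (K : set (R3 R)) : Prop :=
  match k with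
  | 0 => trivial_knot K
  | k'.+1 => exists (n : nat) (v v' : 'I_n -> R3 R),
      [/\ ambient_isotopic K (polygon v), crossing_change v v'
        & unknotted_by k' (polygon v')]
  end.

(* The infimum of a set of natural numbers, hence its minimum as soon as the set
   is nonempty; it is +oo if no sequence of crossing changes unknots K (which
   happens only if K is not a tame knot). *)
Definition unknotting_number (R : realType) (K : set (R3 R)) : \bar R :=
  ereal_inf [set (k%:R)%:E | k in [set k : nat | unknotted_by k K]].

(* Braid words on p strands: (i, true) is the Artin generator sigma_(i+1) and
   (i, false) is its inverse. *)
Definition braid_word (p : nat) : Type := seq ('I_p.-1 * bool).

Definition polyline (R : realType) (s : seq (R3 R)) : set (R3 R) :=
  [set x | exists2 i : nat, (i.+1 < size s)%N & segment s`_i s`_(i.+1) x].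

(* The part, between the levels y = t and y = t + 1, of the strand that is in
   position k at level t, when the letter read there is (i, b). In sigma_(i+1)
   the strand going from position i to position i + 1 passes over (z = 1) the
   strand going from i + 1 to i, which stays in the plane z = 0; in the inverse
   it passes under (z = - 1). *)
Definition strand (R : realType) (i : nat) (b : bool) (t k : nat) :
    seq (R3 R) :=
  let h : R := if b then 1 else - 1 in
  let x : R := k%:R in
  let y : R := t%:R in
  if k == i then
    [:: (x, y, 0); (x + 1 / 3, y + 1 / 3, h); (x + 2 / 3, y + 2 / 3, h);
        (x + 1, y + 1, 0)]
  else if k == i.+1 then [:: (x, y, 0); (x - 1, y + 1, 0)]
  else [:: (x, y, 0); (x, y + 1, 0)].

(* The arc closing up position k of a braid on p strands with m letters, from
   level m back to level 0; these arcs are nested in the plane z = 0, to the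
   right of the braid. *)
Definition closing_arc (R : realType) (p m k : nat) : seq (R3 R) :=
  let d : R := (p - k)%:R in
  let x : R := k%:R in
  let y : R := m%:R in
  [:: (x, y, 0); (x, y + d, 0); (p%:R + d, y + d, 0); (p%:R + d, - d, 0);
      (x, - d, 0); (x, 0, 0)].

Definition braid_closure (R : realType) (p : nat) (w : braid_word p) :
    set (R3 R) :=
  [set x | (exists (t : 'I_(size w)) (k : 'I_p),
              let l := tnth (in_tuple w) t in
              polyline (strand R l.1 l.2 t k) x) \/
           (exists k : 'I_p, polyline (closing_arc R p (size w) k) x)].

Arguments braid_closure R {p} w.

(* With 0-based indices, sigma_(i+1) has exponent (-1)^i. *)
Definition weaving_braid (p q : nat) : braid_word p :=
  flatten (nseq q [seq (i, ~~ odd i) | i : 'I_p.-1 <- enum 'I_p.-1]).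

Definition weaving_knot (R : realType) (p q : nat) : set (R3 R) :=
  braid_closure R (weaving_braid p q).

Arguments weaving_knot R p q : clear implicits.

(* Main.v *)
Require Import Defs.
From mathcomp Require Import all_boot all_order all_algebra.
From mathcomp Require Import all_classical all_reals all_analysis.
From mathcomp Require Import ring lra.
From mathcomp Require Import zify.
Set Implicit Arguments.
Unset Strict Implicit.
Unset Printing Implicit Defensive.
Import Order.TTheory GRing.Theory Num.Theory numFieldNormedType.Exports.
Local Open Scope classical_set_scope.
Local Open Scope ring_scope.

(** Write p = 2 h + 1 and q = n p + r.  In each of the q periods of the braid the
    strand in position 0 runs through all positions, alternately over and under
    the others, and p consecutive periods form a pure braid, in which any two
    strands cross twice.  As p is odd, the strand k passes over the strand
    k + d (mod p) at both crossings when d is odd.  With the strands suitably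
    placed on a circle, each one is thus above the h following ones, and below
    the h preceding ones.  Cutting the circle gives a linear order that is
    wrong for h (h + 1) / 2 pairs; changing their h (h + 1) = (p^2 - 1) / 4
    crossings puts the strands in disjoint layers, where they can be pulled
    straight.  This disposes of n blocks of p periods ([block_count],
    [straighten]).

    There remains an alternating diagram with r (p - 1) crossings, to be made
    monotone.  It may be made decreasing, starting where the strand in position
    0 enters the braid, or increasing, starting just after the first crossing
    of that strand.  The first crossing is right for both, and every other one
    is right for exactly one of them, so the two numbers of changes add up to
    the odd number r (p - 1) - 1, and one of them is at most r (p - 1) / 2 - 1
    ([turn_sign_count]).

    A knot whose height is monotone except along one edge is trivial
    ([ascending_unknot]): it consists of two arcs, each crossing every
    horizontal plane once.  Translating the horizontal planes makes one arc a
    vertical segment, and the other one is then unwound around it by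
    multiplying each plane, seen as the complex line, by a number that depends
    continuously on the height ([untwist]).

    All isotopies are given by such formulas on parallel planes or lines.  For
    changing heights above a fixed projection, the lines are vertical: above each
    crossing the old and the new heights of both strands are related by an
    increasing affine map of the vertical line, and these maps extend to all
    the vertical lines ([vertical_isotopy], [braid_reheight]).  The crossing
    changes need no isotopy at all, since flipping a letter of the word changes
    only heights ([unknotted_by_flips]); that the projection has no other
    double points than the crossings is [vpoint_meet]. *)

(** * Continuity of explicit formulas *)

(** Named so that a continuity goal can be decomposed along its formula. *)
Definition cts (S T : topologicalType) (f : S -> T) : Prop := continuous f.

Lemma ctsD (R : realType) (T : topologicalType) (f g : T -> R) :
  cts f -> cts g -> cts (fun x => f x + g x).
Proof. by move=> cf cg x; apply: (@continuousD R R^o); [exact: cf|exact: cg]. Qed.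

Lemma ctsN (R : realType) (T : topologicalType) (f : T -> R) :
  cts f -> cts (fun x => - f x).
Proof. by move=> cf x; apply: (@continuousN R R^o); exact: cf. Qed.

Lemma ctsM (R : realType) (T : topologicalType) (f g : T -> R) :
  cts f -> cts g -> cts (fun x => f x * g x).
Proof. by move=> cf cg x; apply: continuousM; [exact: cf|exact: cg]. Qed.

Lemma ctsX (R : realType) (T : topologicalType) (f : T -> R) (n : nat) :
  cts f -> cts (fun x => f x ^+ n).
Proof.
move=> cf; elim: n => [|n IH].
  by move=> x; rewrite (_ : (fun y => _) = fun=> 1)//; exact: cst_continuous.
rewrite (_ : (fun x => _) = fun x => f x * f x ^+ n); first exact: ctsM.
by apply/funext => x; rewrite exprS.
Qed.

Lemma ctsV (R : realType) (T : topologicalType) (f : T -> R) :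
  (forall x, f x != 0) -> cts f -> cts (fun x => (f x)^-1).
Proof. by move=> f0 cf x; apply: continuousV; [exact: f0|exact: cf]. Qed.

Lemma cts_max (R : realType) (T : topologicalType) (f g : T -> R) :
  cts f -> cts g -> cts (fun x => Num.max (f x) (g x)).
Proof. by move=> cf cg x; apply: continuous_max; [exact: cf|exact: cg]. Qed.

Lemma cts_min (R : realType) (T : topologicalType) (f g : T -> R) :
  cts f -> cts g -> cts (fun x => Num.min (f x) (g x)).
Proof.
move=> cf cg; have -> : (fun x => Num.min (f x) (g x)) =
   (fun x => - Num.max (- f x) (- g x)).
  by apply/funext => x; rewrite oppr_max !opprK.
exact/ctsN/cts_max/ctsN/cg/ctsN.
Qed.

Lemma cts_cst (S T : topologicalType) (c : T) : cts (fun _ : S => c).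
Proof. by move=> x; exact: cst_continuous. Qed.

Lemma cts_id (T : topologicalType) : cts (fun x : T => x).
Proof. by move=> x; exact: cvg_id. Qed.

Lemma cts_comp (S T U : topologicalType) (g : T -> U) (f : S -> T) :
  cts g -> cts f -> cts (fun x => g (f x)).
Proof.
by move=> cg cf x; apply: (@continuous_comp _ _ _ f g); [exact: cf|exact: cg].
Qed.

Lemma cts_fst (S T U : topologicalType) (f : S -> T * U) :
  cts f -> cts (fun x => (f x).1).
Proof. by move=> cf; apply: (cts_comp (g := fst)) => // x; exact: cvg_fst. Qed.

Lemma cts_snd (S T U : topologicalType) (f : S -> T * U) :
  cts f -> cts (fun x => (f x).2).
Proof. by move=> cf; apply: (cts_comp (g := snd)) => // x; exact: cvg_snd. Qed.

Lemma cts_pair (S T U : topologicalType) (f : S -> T) (g : S -> U) :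
  cts f -> cts g -> cts (fun x => (f x, g x)).
Proof. by move=> cf cg x; apply: cvg_pair; [exact: cf|exact: cg]. Qed.

Lemma cts_sum (R : realType) (T : topologicalType) (n : nat)
    (f : 'I_n -> T -> R) :
  (forall i, cts (f i)) -> cts (fun x => \sum_(i < n) f i x).
Proof.
elim: n f => [|n IH] f cf.
  rewrite (_ : (fun x => _) = fun=> 0); first exact: cts_cst.
  by apply/funext => x; rewrite big_ord0.
rewrite (_ : (fun x => _) = fun x =>
  \sum_(i < n) f (widen_ord (leqnSn n) i) x + f ord_max x).
  by apply: ctsD => //; apply: (IH (fun i => f (widen_ord (leqnSn n) i))).
by apply/funext => x; rewrite big_ord_recr.
Qed.

Definition clamp (R : realType) (a b x : R) : R := Num.max a (Num.min b x).

Lemma clamp_itv (R : realType) (a b x : R) : a <= b -> a <= clamp a b x <= b.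
Proof. by move=> ab; rewrite /clamp le_max lexx ge_max ab ge_min lexx. Qed.

Lemma clamp_id (R : realType) (a b x : R) : a <= x <= b -> clamp a b x = x.
Proof. by move=> /andP[ax xb]; rewrite /clamp min_r// max_r. Qed.

Lemma clamp_lo (R : realType) (a b x : R) : a <= b -> x <= a -> clamp a b x = a.
Proof. by move=> ab xa; rewrite /clamp min_r ?max_l// (le_trans xa). Qed.

Lemma clamp_hi (R : realType) (a b x : R) : a <= b -> b <= x -> clamp a b x = b.
Proof. by move=> ab xa; rewrite /clamp min_l ?max_r. Qed.

Lemma cts_clamp (R : realType) (T : topologicalType) (a b : R) (f : T -> R) :
  cts f -> cts (fun x => clamp a b (f x)).
Proof.
by move=> cf; apply: cts_max; [exact: cts_cst|apply: cts_min cf; exact: cts_cst].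
Qed.

Ltac cts_auto := repeat lazymatch goal with
  | |- cts (fun _ => ?c) => apply: cts_cst
  | |- cts (fun x => x) => apply: cts_id
  | |- cts fst => apply: (@cts_fst _ _ _ (fun x => x))
  | |- cts snd => apply: (@cts_snd _ _ _ (fun x => x))
  | |- cts (fun x => @?f x + @?g x) => apply: (@ctsD _ _ f g)
  | |- cts (fun x => @?f x * @?g x) => apply: (@ctsM _ _ f g)
  | |- cts (fun x => @?f x ^+ ?n) => apply: (@ctsX _ _ f n)
  | |- cts (fun x => - @?f x) => apply: (@ctsN _ _ f)
  | |- cts (fun x => Num.max (@?f x) (@?g x)) => apply: (@cts_max _ _ f g)
  | |- cts (fun x => Num.min (@?f x) (@?g x)) => apply: (@cts_min _ _ f g)
  | |- cts (fun x => clamp ?a ?b (@?f x)) => apply: (@cts_clamp _ _ a b f)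
  | |- cts (fun x => (@?f x, @?g x)) => apply: (@cts_pair _ _ _ f g)
  | |- cts (fun x => (@?f x).1) => apply: (@cts_fst _ _ _ f)
  | |- cts (fun x => (@?f x).2) => apply: (@cts_snd _ _ _ f)
  | |- cts (fun x => \sum_(i < ?n) @?f i x) => apply: (@cts_sum _ _ n f) => ?
  end.

(** * Ambient isotopies *)

(** Asking for continuity at all times, and not only on [0, 1], makes the
    concatenation of isotopies a composition with clamped times. *)
Definition isotopic (R : realType) (K L : set (R3 R)) : Prop :=
  exists F : R -> R3 R -> R3 R,
    [/\ cts (fun u : R * R3 R => F u.1 u.2),
        forall t, 0 <= t <= 1 -> homeomorphism (F t),
        forall x, F 0 x = x
      & F 1 @` K = L].

Lemma isotopic_ambient (R : realType) (K L : set (R3 R)) :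
  isotopic K L -> ambient_isotopic K L.
Proof.
move=> [F [cF hF F0 F1]]; exists F; split => //.
exact: continuous_subspaceT.
Qed.

Lemma isotopic_refl (R : realType) (K : set (R3 R)) : isotopic K K.
Proof.
exists (fun _ x => x); split => //; last by rewrite image_id.
  by cts_auto.
by move=> t _; split; [exact: cts_id|exists id; split => //; exact: cts_id].
Qed.

Lemma homeomorphism_comp (T : topologicalType) (f g : T -> T) :
  homeomorphism f -> homeomorphism g -> homeomorphism (fun x => f (g x)).
Proof.
move=> [cf [f' [cf' fK f'K]]] [cg [g' [cg' gK g'K]]].
split; first exact: cts_comp.
exists (fun x => g' (f' x)); split; first exact: cts_comp.
- by move=> x; rewrite fK gK.
- by move=> x; rewrite g'K f'K.
Qed.

Lemma isotopic_trans (R : realType) (K L M : set (R3 R)) :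
  isotopic K L -> isotopic L M -> isotopic K M.
Proof.
move=> [F [cF hF F0 F1]] [G [cG hG G0 G1]].
exists (fun t x => G (clamp 0 1 (2 * t - 1)) (F (clamp 0 1 (2 * t)) x)); split.
- have c1 (c : R) : cts (fun u : R * R3 R => clamp 0 1 (2 * u.1 - c)).
    by apply: cts_clamp; cts_auto.
  apply: (cts_comp (g := fun u : R * R3 R => G u.1 u.2)
    (f := fun u : R * R3 R =>
       (clamp 0 1 (2 * u.1 - 1), F (clamp 0 1 (2 * u.1)) u.2))) => //.
  apply: cts_pair => //.
  apply: (cts_comp (g := fun u : R * R3 R => F u.1 u.2)
    (f := fun u : R * R3 R => (clamp 0 1 (2 * u.1), u.2))) => //.
  apply: cts_pair; last by cts_auto.
  by apply: cts_clamp; cts_auto.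
- move=> t _; apply: homeomorphism_comp; [apply: hG|apply: hF];
  exact: clamp_itv.
- by move=> x; rewrite !clamp_lo ?F0 ?G0 ?mulr0//; lra.
- have h (c : R) : 0 <= c <= 1 -> clamp 0 1 (2 * 1 - c) = 1.
    by move=> c01; rewrite clamp_hi//; lra.
  have := h 0; rewrite subr0 => ->; last by lra.
  rewrite h; last by lra.
  by rewrite -[M]G1 -[L]F1 -image_comp.
Qed.

Lemma isotopic_of_maps (R : realType) (K L : set (R3 R))
    (F G : R -> R3 R -> R3 R) :
  cts (fun u : R * R3 R => F u.1 u.2) ->
  (forall t, 0 <= t <= 1 -> cts (G t)) ->
  (forall t, 0 <= t <= 1 -> cancel (F t) (G t)) ->
  (forall t, 0 <= t <= 1 -> cancel (G t) (F t)) ->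
  (forall x, F 0 x = x) -> F 1 @` K = L -> isotopic K L.
Proof.
move=> cF cG FK GK F0 F1; exists F; split => // t t01; split.
  apply: (cts_comp (g := fun u : R * R3 R => F u.1 u.2)
           (f := fun x => (t, x))) => //.
  by cts_auto.
by exists (G t); split; [exact: cG|exact: FK|exact: GK].
Qed.

(** The increasing affine maps of a line form a convex set, so that the
    straight-line family from the identity consists of homeomorphisms. *)
Lemma isotopic_affine_z (R : realType) (al be : R * R -> R) (K L : set (R3 R)) :
  cts al -> cts be -> (forall q, 0 < al q) ->
  [set (x.1, al x.1 * x.2 + be x.1) | x in K] = L -> isotopic K L.
Proof.
move=> ca cb a0 KL.
have ca' (T : topologicalType) (f : T -> R * R) : cts f ->
    cts (fun x => al (f x)) by exact: cts_comp.
have cb' (T : topologicalType) (f : T -> R * R) : cts f ->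
    cts (fun x => be (f x)) by exact: cts_comp.
have pos t q : 0 <= t <= 1 -> 0 < 1 - t + t * al q.
  by move=> /andP[t0 t1]; have := a0 q; nra.
apply: (isotopic_of_maps
  (F := fun t x => (x.1, (1 - t + t * al x.1) * x.2 + t * be x.1))
  (G := fun t x => (x.1, (1 - t + t * al x.1)^-1 * (x.2 - t * be x.1)))).
- by cts_auto; (apply: ca' || apply: cb'); cts_auto.
- move=> t t01; cts_auto; [apply: ctsV|by apply: cb'; cts_auto].
    by move=> x; rewrite gt_eqF// pos.
  by cts_auto; apply: ca'; cts_auto.
- by move=> t t01 [x z] /=; rewrite addrK mulKf// gt_eqF// pos.
- by move=> t t01 [x z] /=; rewrite mulVKf ?subrK// gt_eqF// pos.
- by move=> [x z] /=; congr pair; ring.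
- rewrite -KL; apply: eq_imagel => x _ /=; congr pair; ring.
Qed.

Lemma isotopic_shear_x (R : realType) (g : R * R -> R) (K L : set (R3 R)) :
  cts g ->
  [set ((x.1.1 - g (x.1.2, x.2), x.1.2), x.2) | x in K] = L -> isotopic K L.
Proof.
move=> cg KL.
have cg' (T : topologicalType) (f : T -> R * R) : cts f ->
    cts (fun x => g (f x)) by exact: cts_comp.
apply: (isotopic_of_maps
  (F := fun t x => ((x.1.1 - t * g (x.1.2, x.2), x.1.2), x.2))
  (G := fun t x => ((x.1.1 + t * g (x.1.2, x.2), x.1.2), x.2))).
- by cts_auto; apply: cg'; cts_auto.
- by move=> t _; cts_auto; apply: cg'; cts_auto.
- by move=> t _ [[x y] z] /=; rewrite subrK.
- by move=> t _ [[x y] z] /=; rewrite addrK.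
- by move=> [[x y] z] /=; rewrite mul0r subr0.
- by rewrite -KL; apply: eq_imagel => x _ /=; rewrite mul1r.
Qed.

Lemma isotopic_level_shift (R : realType) (a b : R -> R) (K L : set (R3 R)) :
  cts a -> cts b ->
  [set ((x.1.1 - a x.2, x.1.2 - b x.2), x.2) | x in K] = L -> isotopic K L.
Proof.
move=> ca cb KL.
have ca' (T : topologicalType) (f : T -> R) : cts f ->
    cts (fun x => a (f x)) by exact: cts_comp.
have cb' (T : topologicalType) (f : T -> R) : cts f ->
    cts (fun x => b (f x)) by exact: cts_comp.
apply: (isotopic_of_maps
  (F := fun t x => ((x.1.1 - t * a x.2, x.1.2 - t * b x.2), x.2))
  (G := fun t x => ((x.1.1 + t * a x.2, x.1.2 + t * b x.2), x.2))).
- by cts_auto; (apply: ca' || apply: cb'); cts_auto.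
- by move=> t _; cts_auto; (apply: ca' || apply: cb'); cts_auto.
- by move=> t _ [[x y] z] /=; rewrite !subrK.
- by move=> t _ [[x y] z] /=; rewrite !addrK.
- by move=> [[x y] z] /=; rewrite !mul0r !subr0.
- by rewrite -KL; apply: eq_imagel => x _ /=; rewrite !mul1r.
Qed.

Lemma sqr_norm_gt0 (R : realType) (a b : R) :
  ~ (a <= 0 /\ b = 0) -> 0 < a ^+ 2 + b ^+ 2.
Proof.
move=> ab; have [b0|b0] := eqVneq b 0.
  by have : 0 < a; [rewrite ltNge; apply/negP => a0; apply: ab|nra].
by have : 0 < b ^+ 2; [rewrite exprn_even_gt0//|nra].
Qed.

(** The complex plane slit along the nonpositive reals is star-shaped around 1:
    the multipliers 1 - t + t (a + ib) never vanish. *)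
Lemma isotopic_twist (R : realType) (a b : R -> R) (K L : set (R3 R)) :
  cts a -> cts b ->
  (forall z, ~ (a z <= 0 /\ b z = 0)) ->
  [set ((a x.2 * x.1.1 - b x.2 * x.1.2, b x.2 * x.1.1 + a x.2 * x.1.2), x.2)
     | x in K] = L -> isotopic K L.
Proof.
move=> ca cb ab KL.
have ca' (T : topologicalType) (f : T -> R) : cts f ->
    cts (fun x => a (f x)) by exact: cts_comp.
have cb' (T : topologicalType) (f : T -> R) : cts f ->
    cts (fun x => b (f x)) by exact: cts_comp.
pose A t z := 1 - t + t * a z.
pose B t z := t * b z.
pose N t z := (A t z ^+ 2 + B t z ^+ 2)^-1.
have nz t z : 0 <= t <= 1 -> A t z ^+ 2 + B t z ^+ 2 != 0.
  move=> /andP[t0 t1]; rewrite gt_eqF//; apply: sqr_norm_gt0; rewrite /A /B.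
  move=> [A0 /eqP]; rewrite mulf_eq0 => /orP[/eqP t00|/eqP b0].
    by move: A0; rewrite t00; lra.
  apply: (ab z); split => //; have : t != 0.
    by apply/eqP => t00; move: A0; rewrite t00; lra.
  by move=> tn0; have : 0 < t; [lra|nra].
apply: (isotopic_of_maps
  (F := fun t x => ((A t x.2 * x.1.1 - B t x.2 * x.1.2,
                     B t x.2 * x.1.1 + A t x.2 * x.1.2), x.2))
  (G := fun t x => (((A t x.2 * x.1.1 + B t x.2 * x.1.2) * N t x.2,
                     (A t x.2 * x.1.2 - B t x.2 * x.1.1) * N t x.2), x.2))).
- by rewrite /A /B; cts_auto; (apply: ca' || apply: cb'); cts_auto.
- have cA t : cts (fun x : R3 R => A t x.2).
    by rewrite /A; cts_auto; apply: ca'; cts_auto.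
  have cB t : cts (fun x : R3 R => B t x.2).
    by rewrite /B; cts_auto; apply: cb'; cts_auto.
  move=> t t01; have cN : cts (fun x : R3 R => N t x.2).
    rewrite /N; apply: ctsV; first by move=> x; exact: nz.
    by rewrite /A /B; cts_auto; (apply: ca' || apply: cb'); cts_auto.
  by cts_auto => //; exact: cA || exact: cB || exact: cN.
- move=> t t01 [[x y] z] /=; have := nz t z t01; rewrite /N.
  by move: (A t z) (B t z) => p q pq; congr (_, _, _); field.
- move=> t t01 [[x y] z] /=; have := nz t z t01; rewrite /N.
  by move: (A t z) (B t z) => p q pq; congr (_, _, _); field.
- by move=> [[x y] z] /=; congr (_, _, _); rewrite /A /B; ring.
- rewrite -KL; apply: eq_imagel => x _ /=; congr (_, _, _); rewrite /A /B; ring.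
Qed.

(** * Moving a polygon along the vertical direction *)

Definition lin (R : realType) (a b t : R) : R := (1 - t) * a + t * b.

Definition lin2 (R : realType) (a b : R * R) (t : R) : R * R :=
  (lin a.1 b.1 t, lin a.2 b.2 t).

Lemma lin0 (R : realType) (a b : R) : lin a b 0 = a.
Proof. by rewrite /lin; ring. Qed.

Lemma lin1 (R : realType) (a b : R) : lin a b 1 = b.
Proof. by rewrite /lin; ring. Qed.

Lemma segmentE (R : realType) (a b : R3 R) (t : R) :
  (1 - t) *: a + t *: b = (lin2 a.1 b.1 t, lin a.2 b.2 t).
Proof. by case: a b => [[? ?] ?] [[? ?] ?]. Qed.

(** By pasting, the common function is continuous on the compact union of the
    sets, from which Tietze's theorem extends it. *)
Lemma cts_ex_glue (R : realType) (n : nat) (A : 'I_n -> set (R * R))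
    (f : 'I_n -> R * R -> R) :
  (forall i, compact (A i)) -> (forall i, cts (f i)) ->
  (forall i j q, A i q -> A j q -> f i q = f j q) ->
  exists2 g : R * R -> R, cts g & forall i q, A i q -> g q = f i q.
Proof.
move=> cA cf ff.
have clA i : closed (A i).
  by apply: compact_closed (cA i); exact: norm_hausdorff.
have [g0 g0E] : exists g0 : R * R -> R, forall i q, A i q -> g0 q = f i q.
  have h q : exists y, forall i, A i q -> y = f i q.
    have [[i Ai]|nA] := pselect (exists i, A i q).
      by exists (f i q) => j Aj; exact: ff.
    by exists 0 => i Ai; case: nA; exists i.
  by have [g gE] := choice h; exists g => i q; exact: gE.
pose U (s : seq 'I_n) := \big[setU/set0]_(i <- s) A i.
have [clU [cU ctU]] : closed (U (enum 'I_n)) /\ compact (U (enum 'I_n)) /\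
    {within U (enum 'I_n), continuous g0}.
  elim: (enum 'I_n) => [|i s [clU [cU ctU]]]; rewrite /U.
    rewrite big_nil; split; first exact: closed0.
    by split; [exact: compact0|exact: continuous_subspace0].
  rewrite big_cons -/(U s); split; first exact: closedU.
  split; first exact: compactU.
  apply: withinU_continuous => //.
  apply: (@subspace_eq_continuous _ (A i) _ (f i)).
    by move=> q /set_mem Aiq; exact/esym/g0E.
  by apply: continuous_subspaceT => q; exact: cf.
have AU i : A i `<=` U (enum 'I_n).
  rewrite /U => q Aq; have : i \in enum 'I_n by rewrite mem_enum.
  elim: (enum _) => // j s IH; rewrite inE big_cons => /orP[/eqP <-|/IH]; first by left.
  by right.
have [M M0 Mb] : exists2 M : R, 0 < M & forall q, U (enum 'I_n) q -> `|g0 q| <= M.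
  have := compact_bounded (continuous_compact ctU cU).
  move=> /pinfty_ex_gt0[M M0 MM]; exists M => // q Uq.
  by apply: MM; exists q.
have [g [gE cg _]] := continuous_bounded_extension
  (@pseudometric_normal R _) clU M0 ctU Mb.
exists g => // i q Aq; rewrite -gE ?(g0E i)//.
by apply/mem_set/(AU i).
Qed.

Lemma cts_lin2 (R : realType) (a b : R * R) : cts (lin2 a b).
Proof. by rewrite /lin2 /lin; cts_auto. Qed.

(** The orthogonal projection onto the line through a and b. *)
Lemma lin2_coordinate (R : realType) (a b : R * R) : a <> b ->
  exists2 s : R * R -> R, cts s & forall t, s (lin2 a b t) = t.
Proof.
case: a b => [a1 a2] [b1 b2] ab.
pose N := (b1 - a1) ^+ 2 + (b2 - a2) ^+ 2.
have N0 : N != 0.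
  apply/eqP => N0; apply: ab.
  by congr pair; apply/eqP; rewrite eq_sym -subr_eq0 -sqrf_eq0; apply/eqP;
    have := sqr_ge0 (b1 - a1); have := sqr_ge0 (b2 - a2); rewrite /N in N0; lra.
exists (fun q => ((q.1 - a1) * (b1 - a1) + (q.2 - a2) * (b2 - a2)) * N^-1).
  by cts_auto.
by move=> t; apply: (canLR (mulfK N0)); rewrite /lin2 /lin /N /=; ring.
Qed.

Definition at_heights (R : realType) (n : nat) (q : 'I_n -> R * R) (z : 'I_n -> R) :
  'I_n -> R3 R := fun i => (q i, z i).

(** Over the projection q, the affine maps of slope al of the vertical lines are
    determined by the condition of carrying z to z'; they extend to the other
    vertical lines by Tietze's theorem. *)
Lemma vertical_isotopy (R : realType) (n : nat) (q : 'I_n -> R * R)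
    (z z' : 'I_n -> R) (al : R -> R) :
  cts al -> (forall y, 0 < al y) ->
  (forall i, q i <> q (ordS i)) ->
  (forall i j s t, 0 <= s <= 1 -> 0 <= t <= 1 ->
     lin2 (q i) (q (ordS i)) s = lin2 (q j) (q (ordS j)) t ->
     lin (z' i) (z' (ordS i)) s -
       al (lin (q i).2 (q (ordS i)).2 s) * lin (z i) (z (ordS i)) s =
     lin (z' j) (z' (ordS j)) t -
       al (lin (q j).2 (q (ordS j)).2 t) * lin (z j) (z (ordS j)) t) ->
  isotopic (polygon (at_heights q z)) (polygon (at_heights q z')).
Proof.
move=> cal al0 qq H.
pose A i := lin2 (q i) (q (ordS i)) @` `[0, 1]%classic.
have [sg sgP] : exists sg : 'I_n -> R * R -> R, forall i,
    cts (sg i) /\ forall t, sg i (lin2 (q i) (q (ordS i)) t) = t.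
  have h i : exists s : R * R -> R,
      cts s /\ forall t, s (lin2 (q i) (q (ordS i)) t) = t.
    by have [s cs sE] := lin2_coordinate (qq i); exists s.
  by have [sg sgP] := choice h; exists sg.
pose f i x := lin (z' i) (z' (ordS i)) (sg i x) -
       al (lin (q i).2 (q (ordS i)).2 (sg i x)) *
       lin (z i) (z (ordS i)) (sg i x).
have fE i t : f i (lin2 (q i) (q (ordS i)) t) = lin (z' i) (z' (ordS i)) t -
    al (lin (q i).2 (q (ordS i)).2 t) * lin (z i) (z (ordS i)) t.
  by rewrite /f (proj2 (sgP i)).
have [be cbe beE] : exists2 be, cts be & forall i x, A i x -> be x = f i x.
  apply: cts_ex_glue.
  - move=> i; apply: continuous_compact; last exact: segment_compact.
    by apply: continuous_subspaceT => x; exact: cts_lin2.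
  - move=> i; have [cs _] := sgP i; rewrite /f /lin; cts_auto => //.
    by apply: (cts_comp (g := al)) => //; cts_auto.
  - move=> i j x [s s01 <-] [t t01 e]; rewrite fE -e fE.
    exact: H.
apply: (isotopic_affine_z (al := fun x => al x.2) (be := be)) => //.
  by apply: (cts_comp (g := al)) => //; cts_auto.
have key i t : 0 <= t <= 1 ->
    let x := lin2 (q i) (q (ordS i)) t in
    al x.2 * lin (z i) (z (ordS i)) t + be x = lin (z' i) (z' (ordS i)) t.
  move=> t01 x; rewrite (beE i); last by exists t.
  by rewrite /f (proj2 (sgP i)) /= addrC subrK.
apply/seteqP; split => [_ [x [i [t t01 ->]] <-]|x [i [t t01 ->]]].
  exists i, t => //; rewrite !segmentE /= key//.
exists (lin2 (q i) (q (ordS i)) t, lin (z i) (z (ordS i)) t).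
  by exists i, t => //; rewrite segmentE.
by rewrite segmentE /= key.
Qed.

(** * One-bridge knots are trivial *)

(** The piecewise affine function with value u i at the integers i <= n. *)
Definition pl (R : realType) (n : nat) (u : nat -> R) (z : R) : R :=
  u 0%N + \sum_(i < n) (u i.+1 - u i) * clamp 0 1 (z - i%:R).

Lemma cts_pl (R : realType) (n : nat) (u : nat -> R) : cts (pl n u).
Proof. by rewrite /pl; cts_auto. Qed.

Lemma plE (R : realType) (n : nat) (u : nat -> R) (i : nat) (t : R) :
  (i < n)%N -> 0 <= t <= 1 -> pl n u (i%:R + t) = lin (u i) (u i.+1) t.
Proof.
move=> ltin /andP[t0 t1]; rewrite /pl -(big_mkord xpredT
  (fun j => (u j.+1 - u j) * clamp 0 1 (i%:R + t - j%:R))).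
rewrite (big_cat_nat (leq0n i) (ltnW ltin)) /= (big_ltn ltin).
rewrite (eq_big_nat _ _ (F2 := fun j => u j.+1 - u j)); last first.
  move=> j /andP[_ ji]; rewrite clamp_hi ?mulr1//.
  have : (j.+1%:R <= i%:R :> R) by rewrite ler_nat.
  by rewrite -natr1; lra.
rewrite telescope_sumr// [X in _ + (_ + (_ + X))]big_nat big1 ?addr0; last first.
  move=> j /andP[ij _]; rewrite clamp_lo ?mulr0//.
  have : (i.+1%:R <= j%:R :> R) by rewrite ler_nat.
  by rewrite -natr1; lra.
rewrite (_ : i%:R + t - i%:R = t); last by ring.
by rewrite clamp_id ?t0// /lin; ring.
Qed.

Lemma pl_nat (R : realType) (n : nat) (u : nat -> R) (i : nat) :
  (0 < n)%N -> (i <= n)%N -> pl n u i%:R = u i.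
Proof.
move=> n0; rewrite leq_eqVlt => /orP[/eqP ->|ltin]; last first.
  by rewrite -[i%:R]addr0 plE// ?lin0// lexx ler01.
case: n n0 => // n _; rewrite -natr1 plE ?lin1//; lra.
Qed.

(** The plane R * R as the complex line. *)
Definition cmul (R : realType) (a b : R * R) : R * R :=
  (a.1 * b.1 - a.2 * b.2, a.2 * b.1 + a.1 * b.2).

Definition cconj (R : realType) (a : R * R) : R * R := (a.1, - a.2).

Lemma cmulA (R : realType) (a b c : R * R) :
  cmul a (cmul b c) = cmul (cmul a b) c.
Proof. by rewrite /cmul /=; congr pair; ring. Qed.

Lemma sqr_norm_neq0 (R : realType) (a : R * R) :
  a <> (0, 0) -> 0 < a.1 ^+ 2 + a.2 ^+ 2.
Proof.
case: a => [x y] /= a0; have x2 := sqr_ge0 x; have y2 := sqr_ge0 y.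
rewrite lt_neqAle addr_ge0// andbT eq_sym paddr_eq0// !sqrf_eq0.
by apply/negP => /andP[/eqP x0 /eqP y0]; apply: a0; rewrite x0 y0.
Qed.

Lemma cmul_eq0 (R : realType) (a b : R * R) :
  cmul a b = (0, 0) -> a = (0, 0) \/ b = (0, 0).
Proof.
move=> ab; have [->|a0] := pselect (a = (0, 0)); [by left|right].
have := sqr_norm_neq0 a0; set N := _ + _ => N0.
have nN : N != 0 by rewrite gt_eqF.
case: ab => e1 e2; case: a b a0 @N N0 nN e1 e2 => [a1 a2] [b1 b2] /= _ N0 nN e1 e2.
congr pair; apply: (mulfI nN); rewrite mulr0.
  transitivity (a1 * (a1 * b1 - a2 * b2) + a2 * (a2 * b1 + a1 * b2)); first by ring.
  by rewrite e1 e2; ring.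
transitivity (a1 * (a2 * b1 + a1 * b2) - a2 * (a1 * b1 - a2 * b2)); first by ring.
by rewrite e1 e2; ring.
Qed.

(** A one-bridge knot with one of its two arcs made vertical. *)
Definition with_axis (R : realType) (n : R) (g : R -> R * R) : set (R3 R) :=
  [set x | 0 <= x.2 <= n /\ (x.1 = g x.2 \/ x.1 = (0, 0))].

Lemma twist_with_axis (R : realType) (n : R) (m g : R -> R * R) :
  cts m -> (forall z, ~ ((m z).1 <= 0 /\ (m z).2 = 0)) ->
  isotopic (with_axis n g) (with_axis n (fun z => cmul (m z) (g z))).
Proof.
move=> cm m0.
apply: (isotopic_twist (a := fun z => (m z).1) (b := fun z => (m z).2)) => //.
- by cts_auto.
- by cts_auto.
have mz z : m z <> (0, 0).
  by move=> e; apply: (m0 z); rewrite e /= lexx.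
apply/seteqP; split => [_ [[[x y] z] /= [zn e] <-]|[[x y] z] /= [zn e]].
  split => //=; case: e => [/= <-|[-> ->]]; [by left|right].
  by congr pair; ring.
case: e => [e|[-> ->]]; last first.
  by exists ((0, 0), z) => /=; [split => //; right|congr (_, _, _); ring].
by exists (g z, z) => /=; [split => //; left|move: e => /= ->].
Qed.

Definition unknot (R : realType) (K : set (R3 R)) : Prop :=
  exists2 v : 'I_3 -> R3 R, polygonal_knot v & isotopic K (polygon v).

Lemma unknot_trivial (R : realType) (K : set (R3 R)) : unknot K -> trivial_knot K.
Proof. by move=> [v kv Kv]; exists v; split => //; exact: isotopic_ambient. Qed.

Lemma unknot_isotopic (R : realType) (K L : set (R3 R)) :
  isotopic K L -> unknot L -> unknot K.
Proof. by move=> KL [v kv Lv]; exists v => //; exact: isotopic_trans Lv. Qed.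

Definition triangle (R : realType) (e : R * R) (n : R) (i : 'I_3) : R3 R :=
  nth ((0, 0), n) [:: ((0, 0), 0); (e, 1)] i.

Lemma triangle_knot (R : realType) (e : R * R) (n : R) :
  e <> (0, 0) -> 1 < n -> polygonal_knot (triangle e n).
Proof.
case: e => [x y] e0 n1; have N0 := sqr_norm_neq0 e0; rewrite /= in N0.
clear e0; split => //.
  have h (i j : 'I_3) : (i < j)%N -> triangle (x, y) n i <> triangle (x, y) n j.
    case: i j => [[|[|[|//]]] ?] [[|[|[|//]]] ?] //= _ [] *; try lra.
  move=> i j ij; apply/val_inj; case: (ltngtP i j) => // lt.
    by case: (h _ _ lt).
  by case: (h _ _ lt).
have S2 (P : 'I_3 -> Prop) : P ord0 -> P (lift ord0 ord0) -> P ord_max -> forall i, P i.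
  move=> P0 P1 P2 [[|[|[|//]]] hi].
  - by rewrite (_ : Ordinal hi = ord0)//; apply/val_inj.
  - by rewrite (_ : Ordinal hi = lift ord0 ord0)//; apply/val_inj.
  - by rewrite (_ : Ordinal hi = ord_max)//; apply/val_inj.
have e01 : ordS (@ord0 2) = lift ord0 ord0 by apply/val_inj.
have e12 : ordS (lift (@ord0 2) (@ord0 1)) = ord_max by apply/val_inj.
have e20 : ordS (@ord_max 2) = ord0 by apply/val_inj.
have xy s : s * x = 0 -> s * y = 0 -> s = 0.
  move=> sx sy; have : s * (x ^+ 2 + y ^+ 2) = 0.
    by rewrite mulrDr !expr2 !mulrA sx sy !mul0r addr0.
  by move=> /eqP; rewrite mulf_eq0 (gt_eqF N0) orbF => /eqP.
have E p q (z : R3 R) (t : R) : z = (1 - t) *: p + t *: q ->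
  z = (lin2 p.1 q.1 t, lin p.2 q.2 t) by rewrite segmentE.
have p01 z : edge (triangle (x, y) n) ord0 z ->
    edge (triangle (x, y) n) (lift ord0 ord0) z -> z = ((x, y), 1).
  move=> [s /andP[s0 s1] /E ->] [t /andP[t0 t1] /E]; rewrite e01 e12 /lin2 /lin /=.
  move=> [e1 e2 e3]; have : s = 1 by nra.
  by move=> ->; congr (_, _, _); ring.
have p12 z : edge (triangle (x, y) n) (lift ord0 ord0) z ->
    edge (triangle (x, y) n) ord_max z -> z = ((0, 0), n).
  move=> [s /andP[s0 s1] /E ->] [t /andP[t0 t1] /E]; rewrite e12 e20 /lin2 /lin /=.
  move=> [e1 e2 e3]; have /eqP : 1 - s = 0 by apply: xy; lra.
  by rewrite subr_eq0 => /eqP <-; congr (_, _, _); ring.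
have p20 z : edge (triangle (x, y) n) ord_max z ->
    edge (triangle (x, y) n) ord0 z -> z = ((0, 0), 0).
  move=> [t /andP[t0 t1] /E ->] [s /andP[s0 s1] /E]; rewrite e01 e20 /lin2 /lin /=.
  move=> [e1 e2 e3]; have s00 : s = 0 by apply: xy; lra.
  by move: e1 e2 e3; rewrite s00 => *; congr (_, _, _); lra.
elim/S2; elim/S2 => // z _ h1 h2; rewrite ?e01 ?e12 ?e20.
- by left; split => //; rewrite (p01 z).
- by right; split => //; rewrite (p20 z).
- by right; split => //; rewrite (p01 z).
- by left; split => //; rewrite (p12 z).
- by left; split => //; rewrite (p20 z).
- by right; split => //; rewrite (p12 z).
Qed.

Lemma with_axis_triangle (R : realType) (e : R * R) (n : R) (T : R -> R * R) :
  1 < n ->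
  (forall z, 0 <= z <= 1 -> T z = (z * e.1, z * e.2)) ->
  (forall z, 1 <= z <= n ->
     T z = ((n - z) / (n - 1) * e.1, (n - z) / (n - 1) * e.2)) ->
  with_axis n T = polygon (triangle e n).
Proof.
move=> n1 T0 T1; have n10 : n - 1 != 0 by rewrite subr_eq0 gt_eqF.
have nn0 : n != 0 by rewrite gt_eqF//; lra.
have e01 : ordS (@ord0 2) = lift ord0 ord0 by apply/val_inj.
have e12 : ordS (lift (@ord0 2) (@ord0 1)) = ord_max by apply/val_inj.
have e20 : ordS (@ord_max 2) = ord0 by apply/val_inj.
apply/seteqP; split => [[q z] [/= /andP[z0 zn] [/= ->|/= ->]]|x].
- have [z1|z1] := leP z 1.
    exists ord0, z; first by rewrite z0.
    by rewrite segmentE e01 T0 ?z0// /lin2 /lin /=; congr (_, _, _); ring.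
  exists (lift ord0 ord0), ((z - 1) / (n - 1)).
    by rewrite divr_ge0 ?ler_pdivrMr//; lra.
  by rewrite segmentE e12 T1 ?zn ?ltW// /lin2 /lin /=; congr (_, _, _); field.
- exists ord_max, (1 - z / n).
    rewrite subr_ge0 ler_pdivrMr; last lra.
    by rewrite mul1r zn /= lerBlDr lerDl divr_ge0//; lra.
  by rewrite segmentE e20 /lin2 /lin /=; congr (_, _, _); field.
- move=> [i [t /andP[t0 t1] ->]]; rewrite segmentE /edge.
  case: i => [[|[|[|//]]] hi].
  + rewrite (_ : Ordinal hi = ord0); last exact/val_inj.
    rewrite e01 /with_axis /lin2 /lin /=; split; first lra.
    left; rewrite T0; last by lra.
    by congr pair; ring.
  + rewrite (_ : Ordinal hi = lift ord0 ord0); last exact/val_inj.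
    rewrite e12 /with_axis /lin2 /lin /=; split; first nra.
    left; rewrite T1; last by nra.
    by congr pair; field.
  + rewrite (_ : Ordinal hi = ord_max); last exact/val_inj.
    rewrite e20 /with_axis /lin2 /lin /=; split; first nra.
    by right; congr pair; ring.
Qed.

Ltac forget_pairs := repeat match goal with
  | H : _ <> (_, _) |- _ => clear H
  | H : _ = (_, _) |- _ => clear H
  end.
Ltac plra := forget_pairs; lra.
Ltac pnra := forget_pairs; nra.

Lemma cmul_conj_slit (R : realType) (a e : R * R) (l : R) :
  l <= 0 -> a <> (0, 0) -> e <> (0, 0) -> cmul (cconj a) e = (l, 0) ->
  exists2 k : R, 0 < k & a = (- k * e.1, - k * e.2).
Proof.
move=> l0 a0 e0 ae; have Na := sqr_norm_neq0 a0; have Ne := sqr_norm_neq0 e0.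
have [l00|ln0] := eqVneq l 0.
  case: (cmul_eq0 (a := cconj a) (b := e)); first by rewrite ae l00.
    case: a a0 {ae Na} => a1 a2 a0 [a10 /eqP]; rewrite oppr_eq0 => /eqP a20.
    by case: a0; rewrite a10 a20.
  by [].
have lneg : 0 < - l by rewrite oppr_gt0 lt_neqAle ln0.
exists ((a.1 ^+ 2 + a.2 ^+ 2) / - l); first exact: divr_gt0.
have nl : - l != 0 by rewrite oppr_eq0.
case: a e ae {a0 e0} Na Ne => [a1 a2] [e1 e2] /= [r i] _ _.
have h N x : - l * (- (N / - l) * x) = - (N * x) by field.
congr pair; apply: (mulfI nl); rewrite h.
  transitivity (- (a1 * (a1 * e1 - - a2 * e2) - a2 * (- a2 * e1 + a1 * e2))); last by ring.
  by rewrite r i; ring.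
transitivity (- (a2 * (a1 * e1 - - a2 * e2) + a1 * (- a2 * e1 + a1 * e2))); last by ring.
by rewrite r i; ring.
Qed.

(** Untwisting one affine piece at a time.  Along the piece between the heights
    i and i + 1 the curve, already turned to point in the direction e at the
    height i, cannot meet the opposite ray, because the piece misses the axis;
    so dividing by its angle stays in the slit plane. *)
Lemma untwist (R : realType) (n : nat) (u v : nat -> R) (i : nat) :
  (forall z, 0 < z < n%:R -> (pl n u z, pl n v z) <> (0, 0)) ->
  (0 < i)%N -> (i < n)%N ->
  let g z := (pl n u z, pl n v z) in
  let e := g 1 in
  exists M : R -> R * R,
    [/\ cts M,
        forall z, M z <> (0, 0),
        forall z, i%:R <= z -> M z = M i%:R,
        forall z, z <= 1 -> M z = M 1
      & (forall z, 1 <= z <= i%:R ->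
          exists2 k : R, 0 < k & cmul (M z) (g z) = (k * e.1, k * e.2)) /\
        isotopic (with_axis n%:R g) (with_axis n%:R (fun z => cmul (M z) (g z)))].
Proof.
move=> g0 + + g e; elim: i => // i IH _ ltin.
have [->|i0] := eqVneq i 0%N.
  exists (fun=> (1, 0)); split => //; first by cts_auto.
    by move=> z [] /eqP; rewrite oner_eq0.
  split; last first.
    rewrite (_ : (fun z => _) = g); first exact: isotopic_refl.
    by apply/funext => z; rewrite /cmul /g /=; congr pair; ring.
  move=> z /le_anti <-; exists 1 => //.
  by rewrite /cmul /e /=; congr pair; ring.
have i1 : (0 < i)%N by rewrite lt0n.
have [M [cM M0 Mhi Mlo [Mdir Miso]]] := IH i1 (ltnW ltin).
have i1R : 1 <= i%:R :> R by rewrite ler1n.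
have inR : i.+1%:R < n%:R :> R by rewrite ltr_nat.
have iS : i.+1%:R = i%:R + 1 :> R by rewrite natr1.
have e0 : e <> (0, 0).
  by apply: g0; rewrite ltr01 (le_lt_trans _ inR)// ler1n.
have Ne := sqr_norm_neq0 e0.
pose G z := cmul (M z) (g z).
have G0 z : 0 < z < n%:R -> G z <> (0, 0).
  by move=> /g0 gz /cmul_eq0[/M0|/gz].
have cg : cts g by rewrite /g; apply: cts_pair; exact: cts_pl.
have cG : cts G by rewrite /G /cmul; cts_auto.
pose w z : R := clamp i%:R i.+1%:R z.
have wP z : i%:R <= w z <= i.+1%:R by apply: clamp_itv; rewrite ler_nat.
pose m z := cmul (cconj (G (w z))) e.
have cw : cts w by apply: cts_clamp; cts_auto.
have cGw : cts (fun z => G (w z)) by exact: cts_comp.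
have cm : cts m by rewrite /m /cconj /cmul; cts_auto.
have Gw0 z : G (w z) <> (0, 0).
  by apply: G0; have /andP[w1 w2] := wP z; plra.
have mslit z : ~ ((m z).1 <= 0 /\ (m z).2 = 0).
  move=> [m1 m2]; have /andP[w1 w2] := wP z.
  (* The curve would be on the opposite ray at the height w z, so that a convex
     combination of this point with the one at the height i would vanish. *)
  have [k k0 kE] : exists2 k : R, 0 < k & G (w z) = (- k * e.1, - k * e.2).
    apply: (@cmul_conj_slit _ _ e (m z).1) => //.
    by rewrite -/(m z) -m2; case: (m z).
  have [r r0 rE] : exists2 r : R, 0 < r & G i%:R = (r * e.1, r * e.2).
    by apply: Mdir; rewrite i1R lexx.
  pose t := w z - i%:R.
  have t01 : 0 <= t <= 1 by rewrite /t; plra.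
  pose s := t * (r / (r + k)).
  have rk : 0 < r / (r + k) by apply: divr_gt0 => //; plra.
  have rk1 : r / (r + k) <= 1 by rewrite ler_pdivrMr; plra.
  have s01 : 0 <= s <= 1 by rewrite /s; pnra.
  have gis x : 0 <= x <= 1 -> g (i%:R + x) = (lin (u i) (u i.+1) x, lin (v i) (v i.+1) x).
    by move=> x01; rewrite /g !plE// (ltnW ltin).
  have gi : g i%:R = (u i, v i).
    by rewrite -[i%:R]addr0 gis ?lin0// lexx ler01.
  apply: (G0 (i%:R + s)); first by plra.
  have /andP[s0 _] := s01; have /andP[t0 _] := t01.
  have wE : w z = i%:R + t by rewrite /t; ring.
  have Mt : M (i%:R + t) = M i%:R by apply: Mhi; plra.
  have Ms : M (i%:R + s) = M i%:R by apply: Mhi; plra.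
  move: kE rE; rewrite wE /G !gis// gi Mt Ms.
  move: (e) => [e1 e2].
  have rk0 : r + k != 0 by rewrite gt_eqF//; plra.
  case: (M i%:R) => a b; rewrite /cmul /lin /= => -[k1 k2] [r1 r2].
  have sE : s * (r + k) = t * r by rewrite /s; field.
  congr pair; apply: (mulfI rk0); rewrite mulr0.
    transitivity ((r + k) * ((1 - s) * (a * u i - b * v i)) +
      (s * (r + k)) * (a * u i.+1 - b * v i.+1)); first by ring.
    have -> : (s * (r + k)) * (a * u i.+1 - b * v i.+1) =
      r * ((a * ((1 - t) * u i + t * u i.+1) - b * ((1 - t) * v i + t * v i.+1))
       - (1 - t) * (a * u i - b * v i)) by rewrite sE; ring.
    rewrite k1 r1.
    transitivity (r * e1 * (t * r - s * (r + k))); first by ring.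
    by rewrite sE; ring.
  transitivity ((r + k) * ((1 - s) * (b * u i + a * v i)) +
    (s * (r + k)) * (b * u i.+1 + a * v i.+1)); first by ring.
  have -> : (s * (r + k)) * (b * u i.+1 + a * v i.+1) =
    r * ((b * ((1 - t) * u i + t * u i.+1) + a * ((1 - t) * v i + t * v i.+1))
     - (1 - t) * (b * u i + a * v i)) by rewrite sE; ring.
  rewrite k2 r2.
  transitivity (r * e2 * (t * r - s * (r + k))); first by ring.
  by rewrite sE; ring.
have m0 z : m z <> (0, 0).
  by move=> mz; apply: (mslit z); rewrite mz.
exists (fun z => cmul (m z) (M z)); split.
- by rewrite /cmul; cts_auto.
- by move=> z /cmul_eq0[/m0|/M0].
- move=> z iz; rewrite Mhi; last by plra.
  rewrite (Mhi i.+1%:R); last by plra.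
  by rewrite /m /w clamp_hi ?[in RHS]clamp_hi//; plra.
- move=> z z1; rewrite Mlo//.
  by rewrite /m /w clamp_lo ?[in RHS]clamp_lo//; plra.
split; last first.
  apply: (isotopic_trans Miso).
  have -> : (fun z => cmul (cmul (m z) (M z)) (g z)) = (fun z => cmul (m z) (G z)).
    by apply/funext => z; rewrite /G cmulA.
  exact: twist_with_axis.
move=> z /andP[z1 zi]; rewrite -cmulA -/(G z).
have [ziR|iz] := leP z i%:R.
  have [r r0 rE] : exists2 r : R, 0 < r & G z = (r * e.1, r * e.2).
    by apply: Mdir; rewrite z1.
  have [k k0 kE] : exists2 k : R, 0 < k & G i%:R = (k * e.1, k * e.2).
    by apply: Mdir; rewrite i1R lexx.
  exists (k * r * (e.1 ^+ 2 + e.2 ^+ 2)); first by rewrite !mulr_gt0.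
  rewrite rE /m /w clamp_lo//; last by plra.
  by rewrite kE /cmul /cconj /=; congr pair; ring.
exists ((G z).1 ^+ 2 + (G z).2 ^+ 2).
  by apply/sqr_norm_neq0/G0; plra.
rewrite /m /w clamp_id ?zi ?ltW//.
by rewrite /cmul /cconj /=; congr pair; ring.
Qed.

(** Once the curve points in the fixed direction e, positive factors make it two
    sides of a triangle.  It is straight near its ends on the axis, where the
    factors can thus be taken constant. *)
Lemma with_axis_unknot (R : realType) (n : nat) (u v : nat -> R) :
  (1 < n)%N -> u 0%N = 0 -> v 0%N = 0 -> u n = 0 -> v n = 0 ->
  (forall z, 0 < z < n%:R -> (pl n u z, pl n v z) <> (0, 0)) ->
  unknot (with_axis n%:R (fun z => (pl n u z, pl n v z))).
Proof.
move=> n1 u0 v0 un vn g0; case: n n1 un vn g0 => // n n1 un vn g0.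
have nR : n.+1%:R = n%:R + 1 :> R by rewrite natr1.
have n1R : 1 <= n%:R :> R by rewrite ler1n.
have [M [cM M0 Mhi Mlo [Mdir Miso]]] := untwist g0 (n1 : 0 < n)%N (ltnSn n).
set g := fun z : R => (pl n.+1 u z, pl n.+1 v z).
rewrite -/g in Miso *; pose e := g 1; rewrite -/e in Mdir.
have e0 : e <> (0, 0) by apply: g0; plra.
have Ne := sqr_norm_neq0 e0.
have [tri knot] : exists2 t, t = triangle e n.+1%:R & polygonal_knot t.
  by exists (triangle e n.+1%:R) => //; apply: triangle_knot => //; plra.
move=> kt; exists tri => //; rewrite knot.
apply: isotopic_trans Miso _.
pose G z := cmul (M z) (g z).
have cg : cts g by rewrite /g; apply: cts_pair; exact: cts_pl.
have cG : cts G by rewrite /G /cmul; cts_auto.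
pose w z : R := clamp 1 n%:R z.
have cw : cts w by apply: cts_clamp; cts_auto.
have wP z : 1 <= w z <= n%:R by exact: clamp_itv.
(* The distance to the axis, measured in multiples of e. *)
pose k z := ((G (w z)).1 * e.1 + (G (w z)).2 * e.2) / (e.1 ^+ 2 + e.2 ^+ 2).
have kP z : 0 < k z /\ G (w z) = (k z * e.1, k z * e.2).
  have [r r0 rE] := Mdir _ (wP z).
  rewrite /k /G rE /= (_ : (_ / _) = r)//.
  by rewrite -!mulrA -mulrDr -!expr2 mulfK// gt_eqF.
have ck : cts k by rewrite /k; cts_auto; exact: cts_comp.
pose m z := ((n.+1%:R - w z) / n%:R / k z, 0 : R).
have cm : cts m.
  rewrite /m; cts_auto => //; apply: ctsV => // z.
  by rewrite gt_eqF//; case: (kP z).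
have mpos z : 0 < (m z).1.
  have [k0 _] := kP z; have /andP[_ w2] := wP z.
  by rewrite /m /=; apply: divr_gt0 => //; apply: divr_gt0; plra.
have := @twist_with_axis _ n.+1%:R m G cm.
rewrite (@with_axis_triangle _ e _ (fun z => cmul (m z) (G z))).
- by apply=> z [m0 _]; have := mpos z; plra.
- by plra.
- move=> z z01; have [k0 kE] := kP z.
  have wz : w z = 1 by rewrite /w clamp_lo//; plra.
  have -> : G z = (z * k z * e.1, z * k z * e.2).
    have gz : g z = (z * e.1, z * e.2).
      have h q : q 0%N = 0 -> pl n.+1 q z = z * pl n.+1 q 1.
        move=> q0; rewrite -[z]add0r -[1 in RHS]add0r -(_ : 0%:R = 0)//.
        by rewrite !plE ?lexx ?ler01// q0 /lin; ring.
      by rewrite /g /e /g /= !h.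
    move: kE; rewrite /G wz Mlo; last by plra.
    rewrite -/e gz; case: (M 1) => a b; case: (e) => e1 e2; rewrite /cmul /= => -[k1 k2].
    by congr pair; rewrite -[RHS]mulrA -(k1, k2); ring.
  have kn0 : k z != 0 by rewrite gt_eqF.
  have n0 : n%:R != 0 :> R by rewrite gt_eqF//; plra.
  rewrite /cmul /m /= wz nR; congr pair; field; apply/andP; split => //.
- move=> z z01; have [k0 kE] := kP z.
  have kn0 : k z != 0 by rewrite gt_eqF.
  have n0 : n%:R != 0 :> R by rewrite gt_eqF//; plra.
  rewrite nR addrK.
  have [zn|nz] := leP z n%:R.
    have wz : w z = z by rewrite /w clamp_id//; plra.
    rewrite wz in kE; rewrite kE /cmul /m /= wz nR.
    by congr pair; field; apply/andP; split => //.
  have wz : w z = n%:R by rewrite /w clamp_hi//; plra.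
  have -> : G z = ((n.+1%:R - z) * k z * e.1, (n.+1%:R - z) * k z * e.2).
    have gz : g z = ((n.+1%:R - z) * (g n%:R).1, (n.+1%:R - z) * (g n%:R).2).
      have h q : q n.+1%N = 0 -> pl n.+1 q z = (n.+1%:R - z) * pl n.+1 q n%:R.
        move=> q0; rewrite -[in LHS](subrK n%:R z) addrC plE//; last by plra.
        by rewrite pl_nat// q0 /lin nR; ring.
      by rewrite /g /= !h.
    move: kE; rewrite /G wz Mhi; last by plra.
    rewrite gz; case: (M n%:R) => a b; case: (g n%:R) => x y; case: (e) => e1 e2; rewrite /cmul /= => -[k1 k2].
    by congr pair; rewrite -[RHS]mulrA -(k1, k2); ring.
  rewrite /cmul /m /= wz nR.
  by congr pair; field; apply/andP; split => //.
Qed.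

Definition mirror (R : realType) (x : R3 R) : R3 R := (x.1, - x.2).

Lemma mirrorK (R : realType) : involutive (@mirror R).
Proof. by move=> [q z]; rewrite /mirror /= opprK. Qed.

Lemma cts_mirror (R : realType) : cts (@mirror R).
Proof. by rewrite /mirror; cts_auto. Qed.

Lemma isotopic_mirror (R : realType) (K L : set (R3 R)) :
  isotopic K L -> isotopic (@mirror R @` K) (@mirror R @` L).
Proof.
move=> [F [cF hF F0 F1]]; exists (fun t x => mirror (F t (mirror x))); split.
- apply: (cts_comp (g := @mirror R)); first exact: cts_mirror.
  apply: (cts_comp (g := fun u : R * R3 R => F u.1 u.2)
    (f := fun u : R * R3 R => (u.1, mirror u.2))) => //.
  by cts_auto; apply: (cts_comp (g := @mirror R)); [exact: cts_mirror|cts_auto].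
- have hm : homeomorphism (@mirror R).
    split; first exact: cts_mirror.
    by exists (@mirror R); split; [exact: cts_mirror|exact: mirrorK..].
  move=> t t01; apply: (homeomorphism_comp hm).
  by apply: homeomorphism_comp hm; exact: hF.
- by move=> x; rewrite F0 mirrorK.
- apply/seteqP; split => [_ [_ [x Kx <-] <-]|_ [y Ly <-]].
    by rewrite mirrorK -F1; exists (F 1 x) => //; exists x.
  move: Ly; rewrite -F1 => -[x Kx <-].
  by exists (mirror x); [exists x|rewrite mirrorK].
Qed.

Lemma mirror_polygon (R : realType) (n : nat) (v : 'I_n -> R3 R) :
  @mirror R @` polygon v = polygon (fun i => mirror (v i)).
Proof.
have e i t : mirror ((1 - t) *: v i + t *: v (ordS i)) =
    (1 - t) *: mirror (v i) + t *: mirror (v (ordS i)).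
  by rewrite !segmentE /mirror /lin /=; congr pair; ring.
apply/seteqP; split => [_ [_ [i [t t01 ->]] <-]|_ [i [t t01 ->]]].
  by exists i, t.
by rewrite -e; exists ((1 - t) *: v i + t *: v (ordS i)) => //; exists i, t.
Qed.

Lemma unknot_mirror (R : realType) (K : set (R3 R)) :
  unknot (@mirror R @` K) -> unknot K.
Proof.
move=> [v [n3 vinj vcross] Kv]; exists (fun i => mirror (v i)).
  have minj : injective (@mirror R) by exact/inv_inj/mirrorK.
  split => //; first by move=> i j /minj/vinj.
  have h i x : edge (fun i => mirror (v i)) i x -> edge v i (mirror x).
    move=> [t t01 ->]; exists t => //.
    by rewrite !segmentE /mirror /lin /=; congr pair; ring.
  move=> i j x ij /h hi /h hj.
  case: (vcross i j _ ij hi hj) => -[-> e]; [left|right]; split => //.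
    by rewrite -e mirrorK.
  by rewrite -e mirrorK.
rewrite -mirror_polygon; have := isotopic_mirror Kv.
by rewrite image_comp (_ : _ \o _ = id) ?image_id//; apply/funext/mirrorK.
Qed.

Lemma split_integer_part (R : realType) (n : nat) (z : R) :
  (0 < n)%N -> 0 <= z <= n%:R ->
  exists k t, [/\ (k < n)%N, 0 <= t <= 1 & z = k%:R + t].
Proof.
elim: n => // n IH _ /andP[z0 zn].
have [n0|n0] := eqVneq n 0%N.
  by exists 0%N, z; rewrite add0r n0 in zn *; rewrite z0.
have [zn'|nz] := leP z n%:R.
  have n1 : (0 < n)%N by rewrite lt0n.
  have [k [t [kn t01 ->]]] := IH n1 (introT andP (conj z0 zn')).
  by exists k, t; rewrite (ltn_trans kn).
exists n, (z - n%:R); split => //; last by rewrite addrC subrK.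
by move: zn; rewrite -natr1; lra.
Qed.

(** The edges along which the height increases form one arc and the remaining
    edge forms another one, both graphs over the vertical axis; translating the
    horizontal planes moves the second arc into the axis. *)
Lemma ascending_unknot (R : realType) (n s : nat) (q : 'I_n -> R * R) :
  (2 < n)%N -> (s < n)%N ->
  (forall (c i : 'I_n) t t', ordS c = s :> nat -> i != c ->
     0 <= t <= 1 -> 0 < t' < 1 ->
     lin2 (q i) (q (ordS i)) t <> lin2 (q c) (q (ordS c)) t') ->
  unknot (polygon (at_heights q (fun i => ((i + (n - s)) %% n)%N%:R))).
Proof.
case: n q => // N q; rewrite ltnS => N1 sN sep.
have N0 : (0 < N)%N by apply: ltn_trans N1.
have NR : N%:R != 0 :> R by rewrite pnatr_eq0 -lt0n.
have NR0 : 0 < N%:R :> R by rewrite ltr0n.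
pose I k : 'I_N.+1 := Ordinal (ltn_pmod (s + k) (ltn0Sn N)).
pose tau (i : 'I_N.+1) := ((i + (N.+1 - s)) %% N.+1)%N.
have tauI k : (k < N.+1)%N -> tau (I k) = k.
  move=> kN; rewrite /tau /= modnDml addnAC subnKC; last exact: ltnW.
  by rewrite modnDl modn_small.
have Itau i : I (tau i) = i.
  apply/val_inj; rewrite /= /tau modnDmr addnCA subnKC; last exact: ltnW.
  by rewrite modnDr modn_small.
have SI k : ordS (I k) = I k.+1.
  by apply/val_inj; rewrite /= -addn1 modnDml addn1 addnS.
have IN : I N.+1 = I 0%N.
  by apply/val_inj; rewrite /= modnDr addn0.
pose w k := q (I k).
pose a (z : R) := lin (w 0%N).1 (w N).1 (z / N%:R).
pose b (z : R) := lin (w 0%N).2 (w N).2 (z / N%:R).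
pose u k := (w k).1 - a k%:R.
pose v k := (w k).2 - b k%:R.
have plu k t : (k < N)%N -> 0 <= t <= 1 ->
    pl N u (k%:R + t) = lin (w k).1 (w k.+1).1 t - a (k%:R + t).
  by move=> kN t01; rewrite plE// /u /a /lin -natr1; field.
have plv k t : (k < N)%N -> 0 <= t <= 1 ->
    pl N v (k%:R + t) = lin (w k).2 (w k.+1).2 t - b (k%:R + t).
  by move=> kN t01; rewrite plE// /v /b /lin -natr1; field.
set z := fun i : 'I_N.+1 => _.
have ptI k t : (k < N)%N ->
   (1 - t) *: at_heights q z (I k) + t *: at_heights q z (ordS (I k)) =
   (lin2 (w k) (w k.+1) t, k%:R + t).
  move=> kN; rewrite segmentE SI /at_heights /=; congr pair.
  rewrite /z -!/(tau _) !tauI ?ltnS// 1?ltnW// /lin -natr1; ring.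
have ptN t :
   (1 - t) *: at_heights q z (I N) + t *: at_heights q z (ordS (I N)) =
   (lin2 (w 0%N) (w N) (1 - t), (1 - t) * N%:R).
  rewrite segmentE SI IN /at_heights /=; congr pair.
    by rewrite /lin2 /lin; congr pair; ring.
  by rewrite /z -!/(tau _) !tauI// /lin; ring.
apply: (unknot_isotopic (L := with_axis N%:R (fun z => (pl N u z, pl N v z)))).
  apply: (isotopic_level_shift (a := a) (b := b)).
  - by rewrite /a /lin; cts_auto.
  - by rewrite /b /lin; cts_auto.
  apply/seteqP; split => [_ [_ [i [t t01 ->] <-]]|[p h] [/= zN e]].
    have := ltn_ord (I (tau i)); rewrite -[i]Itau.
    have : (tau i < N.+1)%N by rewrite /tau ltn_pmod.
    rewrite ltnS leq_eqVlt => /orP[/eqP ->|tN] _.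
      rewrite ptN /=; split => /=; first by nra.
      right; rewrite /a /b mulfK//; congr pair; ring.
    rewrite ptI//=; split => /=.
      have : (tau i).+1%:R <= N%:R :> R by rewrite ler_nat.
      have : 0 <= (tau i)%:R :> R by exact: ler0n.
      by rewrite -natr1; lra.
    by left; rewrite plu ?plv.
  case: e => /= ->.
    have [k [t [kN t01 ->]]] := split_integer_part N0 zN.
    exists (lin2 (w k) (w k.+1) t, k%:R + t).
      by exists (I k), t => //; rewrite ptI.
    by rewrite /= plu ?plv.
  exists (lin2 (w 0%N) (w N) (h / N%:R), h).
    exists (I N), (1 - h / N%:R).
      rewrite subr_ge0 ler_pdivrMr// mul1r lerBlDr lerDl.
      by case/andP: zN => h0 ->; rewrite divr_ge0// ltW.
    rewrite ptN; congr pair; first by congr lin2; ring.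
    by field.
  by rewrite /= /a /b; congr (_, _, _); ring.
apply: with_axis_unknot => //.
- by rewrite /u /a mul0r lin0 subrr.
- by rewrite /v /b mul0r lin0 subrr.
- by rewrite /u /a divff// lin1 subrr.
- by rewrite /v /b divff// lin1 subrr.
move=> h /andP[h0 hN].
have [k [t [kN t01 hE]]] := split_integer_part N0 (introT andP (conj (ltW h0) (ltW hN))).
rewrite hE plu ?plv// -hE => -[/eqP + /eqP]; rewrite !subr_eq0 => /eqP e1 /eqP e2.
apply: (sep (I N) (I k) t (1 - h / N%:R)) => //.
- by rewrite SI IN /= addn0 modn_small.
- apply/eqP => IkN; have := tauI N (ltnSn N); rewrite -IkN tauI; last exact: ltnW.
  by move=> kNN; rewrite kNN ltnn in kN.
- have : 0 < h / N%:R by exact: divr_gt0.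
  have : h / N%:R < 1 by rewrite ltr_pdivrMr// mul1r.
  by lra.
- rewrite !SI IN -/(w k) -/(w k.+1) -/(w N) -/(w 0%N).
  by rewrite /lin2 e1 e2 /a /b /lin; congr pair; ring.
Qed.

(** * Polygons with a given regular projection *)

Definition same_parameter (R : realType) (n : nat) (i j : 'I_n) (s t : R) : Prop :=
  [\/ i = j /\ s = t, [/\ j = ordS i, s = 1 & t = 0]
    | [/\ i = ordS j, s = 0 & t = 1]].

Definition midpoint (R : realType) (n : nat) (z : 'I_n -> R) (i : 'I_n) : R :=
  lin (z i) (z (ordS i)) 2^-1.

(** The polygon is subdivided so that an edge carries at most one crossing, at its
    midpoint; cross pairs the two edges of each crossing. *)
Record shadow (R : realType) (n : nat) (q : 'I_n -> R * R)
    (cross : 'I_n -> 'I_n -> Prop) : Prop := Shadow {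
  shadow_size : (2 < n)%N;
  cross_sym : forall i j, cross i j -> cross j i;
  cross_fun : forall i j k, cross i j -> cross i k -> j = k;
  cross_neq : forall i j, cross i j -> i <> j;
  cross_meet : forall i j, cross i j ->
    lin2 (q i) (q (ordS i)) 2^-1 = lin2 (q j) (q (ordS j)) 2^-1;
  shadow_meet : forall i j s t, 0 <= s <= 1 -> 0 <= t <= 1 ->
    lin2 (q i) (q (ordS i)) s = lin2 (q j) (q (ordS j)) t ->
    same_parameter i j s t \/ [/\ cross i j, s = 2^-1 & t = 2^-1] }.

Lemma same_parameter_lin (R : realType) (n : nat) (f : 'I_n -> R) (i j : 'I_n)
    (s t : R) : same_parameter i j s t ->
  lin (f i) (f (ordS i)) s = lin (f j) (f (ordS j)) t.
Proof.
by case=> [[-> ->]|[-> -> ->]|[-> -> ->]]; rewrite ?lin0 ?lin1.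
Qed.

Lemma edge_at_heights (R : realType) (n : nat) (q : 'I_n -> R * R)
    (z : 'I_n -> R) (i : 'I_n) (x : R3 R) : edge (at_heights q z) i x ->
  exists2 t : R, 0 <= t <= 1 &
    x = (lin2 (q i) (q (ordS i)) t, lin (z i) (z (ordS i)) t).
Proof. by move=> [t t01 ->]; exists t => //; rewrite segmentE. Qed.

Lemma half_itv (R : realType) : 0 <= (2^-1 : R) <= 1.
Proof. lra. Qed.

Lemma end_params (R : realType) : [/\ 1 <> 0 :> R, 2^-1 <> 1 :> R & 2^-1 <> 0 :> R].
Proof. by split; lra. Qed.

Lemma ordS_neq (n : nat) (i : 'I_n) : (1 < n)%N -> ordS i <> i.
Proof.
move=> n1 /(congr1 val) /=; have := ltn_ord i.
have [lt _|ge lt] := ltnP i.+1 n; first by rewrite modn_small// => /eqP; rewrite gtn_eqF.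
have -> : i.+1 = n by apply/eqP; rewrite eqn_leq lt.
by rewrite modnn => i0; move: ge; rewrite -i0 leqNgt n1.
Qed.

Lemma shadow_edge_neq (R : realType) (n : nat) (q : 'I_n -> R * R) cross :
  shadow q cross -> forall i, q i <> q (ordS i).
Proof.
move=> sh i qi; have n1 := ltnW (shadow_size sh).
have zitv : 0 <= (0 : R) <= 1 by rewrite lexx ler01.
have := @shadow_meet _ _ _ _ sh i (ordS i) 0 0 zitv zitv.
rewrite /lin2 !lin0 -!surjective_pairing => /(_ qi).
case=> [[[/esym/(ordS_neq n1)]|[_ /esym/eqP]|[_ _ /esym/eqP]]|[_ /eqP]] //.
- by rewrite oner_eq0.
- by rewrite oner_eq0.
- by rewrite eq_sym invr_eq0 pnatr_eq0.
Qed.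

Lemma shadow_vertex (R : realType) (n : nat) (q : 'I_n -> R * R) cross :
  shadow q cross -> forall (i j : 'I_n) t, 0 <= t <= 1 ->
  lin2 (q j) (q (ordS j)) t = q i -> j = i \/ ordS j = i.
Proof.
move=> sh i j t t01 e; have zitv : 0 <= (0 : R) <= 1 by rewrite lexx ler01.
have := @shadow_meet _ _ _ _ sh j i t 0 t01 zitv.
rewrite e /lin2 !lin0 -surjective_pairing => /(_ erefl).
case=> [[[-> _]|[-> _ _]|[_ _ /esym/eqP]]|[_ _ /eqP]]; [by left|by right|..].
- by rewrite oner_eq0.
- by rewrite eq_sym invr_eq0 pnatr_eq0.
Qed.

Lemma shadow_knot (R : realType) (n : nat) (q : 'I_n -> R * R) cross (z : 'I_n -> R) :
  shadow q cross -> (forall i j, cross i j -> midpoint z i <> midpoint z j) ->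
  polygonal_knot (at_heights q z).
Proof.
move=> sh zz; have n3 := shadow_size sh; split => //.
  move=> i j [qij _].
  have zitv : 0 <= (0 : R) <= 1 by rewrite lexx ler01.
  have h k : lin2 (q k) (q (ordS k)) 0 = q k.
    by rewrite /lin2 !lin0 -surjective_pairing.
  have := @shadow_meet _ _ _ _ sh i j 0 0 zitv zitv.
  rewrite !h => /(_ qij); case=> [[[] //|[_ /esym/eqP]|[_ _ /esym/eqP]]|[_ /eqP]].
  - by rewrite oner_eq0.
  - by rewrite oner_eq0.
  - by rewrite eq_sym invr_eq0 pnatr_eq0.
move=> i j x ij /edge_at_heights[s s01 ->] /edge_at_heights[t t01 [e1 e2 e3]].
have e : lin2 (q i) (q (ordS i)) s = lin2 (q j) (q (ordS j)) t.
  by rewrite /lin2 e1 e2.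
have [[[/eqP]|[-> -> t0]|[-> -> t1]]|[c s2 t2]] :=
    shadow_meet sh s01 t01 e.
- by rewrite (negPf ij).
- by left; split => //; rewrite /lin2 !lin1 /at_heights -surjective_pairing.
- by right; split => //; rewrite /lin2 !lin0 /at_heights -surjective_pairing.
- by case: (zz _ _ c); rewrite /midpoint -{1}s2 -t2.
Qed.

Lemma shadow_regular (R : realType) (n : nat) (q : 'I_n -> R * R) cross (z : 'I_n -> R) :
  shadow q cross -> regular_projection (at_heights q z).
Proof.
move=> sh; split.
  move=> i j x /eqP ji /eqP ji' /edge_at_heights[t t01 ->] /= e.
  by case: (shadow_vertex sh t01 e).
move=> i j k x y y' /andP[]; rewrite !inE negb_or => /andP[/eqP ij /eqP ik] /andP[/eqP jk _].
move=> /edge_at_heights[s s01 ->] /edge_at_heights[t t01 ->].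
move=> /edge_at_heights[r r01 ->] /= [e1 e2].
have m1 := shadow_meet sh s01 t01 e1.
have m2 := shadow_meet sh s01 r01 (etrans e1 e2).
clear e1 e2.
have [n10 n21 n20] := end_params R.
have ends (l : 'I_n) (t' : R) : i <> l -> same_parameter i l s t' -> s <> 2^-1.
  by move=> il [[]//|[_ -> _]|[_ -> _]]; [exact: nesym|exact: nesym].
case: m1 => [m1|[cij s2 _]]; case: m2 => [m2|[cik s2' _]].
- case: m1 m2 => [[//]|[jE s1 _]|[iE s0 _]] [[//]|[kE s1' _]|[iE' s0' _]].
  + by apply: jk; rewrite jE kE.
  + by apply: n10; rewrite -s1 -s0'.
  + by apply: n10; rewrite -s1' -s0.
  + by apply: jk; apply: (bij_inj (ordS_bij n)); rewrite -iE.
- exact: ends m1 s2'.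
- exact: ends m2 s2.
- by apply: jk; exact: (cross_fun sh cij cik).
Qed.

Lemma passes_overP (R : realType) (n : nat) (q : 'I_n -> R * R) cross (z : 'I_n -> R)
    (i j : 'I_n) : shadow q cross ->
  passes_over (at_heights q z) i j <-> cross i j /\ midpoint z j < midpoint z i.
Proof.
move=> sh; split; last first.
  move=> [c zz]; exists (lin2 (q i) (q (ordS i)) 2^-1, midpoint z i),
    (lin2 (q j) (q (ordS j)) 2^-1, midpoint z j); split => //=.
  - by exists 2^-1; [exact: half_itv|rewrite segmentE].
  - by exists 2^-1; [exact: half_itv|rewrite segmentE].
  - exact: (cross_meet sh c).
move=> [x [y [/edge_at_heights[s s01 ->] /edge_at_heights[t t01 ->] /= e zz]]].
case: (shadow_meet sh s01 t01 e) => [/same_parameter_lin h|[c s2 t2]].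
  by rewrite h ltxx in zz.
by split => //; rewrite /midpoint -{1}t2 -s2.
Qed.

Lemma shadow_crossing_change (R : realType) (n : nat) (q : 'I_n -> R * R) cross
    (z z' : 'I_n -> R) (i j : 'I_n) : shadow q cross ->
  (forall k l, cross k l -> midpoint z k <> midpoint z l) ->
  (forall k l, cross k l -> midpoint z' k <> midpoint z' l) ->
  cross i j -> midpoint z j < midpoint z i -> midpoint z' i < midpoint z' j ->
  (forall k l, cross k l -> (k, l) != (i, j) -> (k, l) != (j, i) ->
     (midpoint z' l < midpoint z' k) = (midpoint z l < midpoint z k)) ->
  crossing_change (at_heights q z) (at_heights q z').
Proof.
move=> sh zz zz' cij zij zij' others; split => //.
- exact: shadow_knot sh zz.
- exact: shadow_knot sh zz'.
- exact: shadow_regular sh.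
exists i, j; split; first by apply/(passes_overP _ _ _ sh).
  by apply/(passes_overP _ _ _ sh); split => //; exact: (cross_sym sh).
by move=> k l kl kl'; split => /(passes_overP _ _ _ sh)[c lt];
  apply/(passes_overP _ _ _ sh); split => //; move: lt; rewrite others.
Qed.

(** Only the crossings constrain the slope al: elsewhere the height of the affine
    map is free. *)
Lemma shadow_isotopy (R : realType) (n : nat) (q : 'I_n -> R * R) cross
    (z z' : 'I_n -> R) (al : R -> R) : shadow q cross ->
  cts al -> (forall y, 0 < al y) ->
  (forall i j, cross i j ->
     midpoint z' i - midpoint z' j =
     al (midpoint (fun k => (q k).2) i) * (midpoint z i - midpoint z j)) ->
  isotopic (polygon (at_heights q z)) (polygon (at_heights q z')).
Proof.
move=> sh cal al0 H; apply: (vertical_isotopy cal al0).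
  exact: shadow_edge_neq sh.
move=> i j s t s01 t01 e.
have ey : lin (q i).2 (q (ordS i)).2 s = lin (q j).2 (q (ordS j)).2 t by case: e.
rewrite -ey; case: (shadow_meet sh s01 t01 e) => [h|[c s2 t2]].
  by rewrite !(same_parameter_lin _ h).
have {H} := H _ _ c; rewrite /midpoint /= s2 t2; clear.
set A := al _; rewrite mulrBr => h.
by move: (A * _) (A * _) h => X Y; lra.
Qed.

(** * The projection of a closed braid *)

Definition swap_at (o : option nat) (k : nat) : nat :=
  if o is Some i then
    if k == i then i.+1 else if k == i.+1 then i else k
  else k.

(** Here k is the position of a strand at level 0, and c t that of the crossing
    between the levels t and t + 1, if there is one. *)
Fixpoint posn (c : nat -> option nat) (t k : nat) : nat :=
  if t is t'.+1 then swap_at (c t') (posn c t' k) else k.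

Lemma swap_at_inj (o : option nat) : injective (swap_at o).
Proof.
case: o => // i j k; rewrite /swap_at.
by case: (j =P i); case: (j =P i.+1); case: (k =P i); case: (k =P i.+1); lia.
Qed.

Lemma posn_inj (c : nat -> option nat) (t : nat) : injective (posn c t).
Proof. by elim: t => // t IH j k /swap_at_inj/IH. Qed.

Lemma posn_lt (p : nat) (c : nat -> option nat) (t k : nat) :
  (forall t' i, c t' = Some i -> (i.+1 < p)%N) -> (k < p)%N -> (posn c t k < p)%N.
Proof.
move=> cp kp; elim: t => //= t IH; rewrite /swap_at.
case e: (c t) => [i|//]; have := cp _ _ e.
by case: eqP => _; [|case: eqP => _]; lia.
Qed.

(** Positions are distinct integers at both levels, so two straight strands can
    only meet if their order is reversed, which happens to the exchanged pair
    alone. *)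
Lemma lin_swap_meet (R : realType) (o : option nat) (j k : nat) (u : R) :
  j <> k -> 0 <= u <= 1 ->
  lin j%:R (swap_at o j)%:R u = lin k%:R (swap_at o k)%:R u ->
  u = 2^-1 /\ exists2 i, o = Some i & (j = i /\ k = i.+1) \/ (j = i.+1 /\ k = i).
Proof.
wlog jk : j k / (j < k)%N.
  move=> H jk u01 e; have [lt|lt|//] := ltngtP j k; first exact: H.
  have [->] := H _ _ lt (nesym jk) u01 (esym e).
  by move=> [i oi h]; split => //; exists i => //; tauto.
move=> _ /andP[u0 u1] e.
have [[i oi [ji ki]]|no] :=
    pselect (exists2 i, o = Some i & j = i /\ k = i.+1).
  split; last by exists i => //; left.
  move: e; rewrite oi /swap_at ji ki eqxx eqn_leq ltnn /= eqxx.
  by rewrite /lin -natr1; lra.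
exfalso; have : (swap_at o j < swap_at o k)%N.
  case: o no {e} => [i|] //= no; have {}no : ~ (j = i /\ k = i.+1).
    by move=> h; apply: no; exists i.
  rewrite /swap_at.
  by case: (j =P i); case: (j =P i.+1); case: (k =P i); case: (k =P i.+1); lia.
move: e jk; rewrite /lin -!(ltr_nat R) => e jk jk'.
by have [u2|u2] := leP u 2^-1; nra.
Qed.

Section Vertices.
Context {R : realType}.
Context (p m : nat) (c : nat -> option nat).

Definition arc_height (k : nat) : R := (p - posn c m k)%:R.

(** The vertices of the strand of position k at level 0 and of the arc that
    closes it: the levels are cut into thirds, so that the crossings are the
    midpoints of the middle thirds. *)
Definition vtx (k l : nat) : R * R :=
  if (l <= 3 * m)%N then
    (lin (posn c (l %/ 3) k)%:R (posn c (l %/ 3).+1 k)%:R ((l %% 3)%:R / 3),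
     l%:R / 3)
  else let d := arc_height k in let x : R := (posn c m k)%:R in
  nth (x, 0) [:: (x, m%:R + d); (p%:R + d, m%:R + d); (p%:R + d, - d); (x, - d)]
      (l - (3 * m).+1).

Definition vpoint (k l : nat) (s : R) : R * R := lin2 (vtx k l) (vtx k l.+1) s.

Lemma lin_lin (a b s t u : R) : lin (lin a b s) (lin a b t) u = lin a b (lin s t u).
Proof. by rewrite /lin; ring. Qed.

Lemma vpoint_strand (k l : nat) (s : R) : (l < 3 * m)%N ->
  vpoint k l s =
  (lin (posn c (l %/ 3) k)%:R (posn c (l %/ 3).+1 k)%:R (((l %% 3)%:R + s) / 3),
   (l%:R + s) / 3).
Proof.
move=> lm; rewrite /vpoint /vtx lm (ltnW lm) /lin2 /=; congr pair; last first.
  by rewrite /lin -natr1; field.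
have [e|e] := eqVneq (l %% 3)%N 2%N; last first.
  have -> : (l.+1 %/ 3 = l %/ 3)%N by lia.
  have -> : (l.+1 %% 3 = (l %% 3).+1)%N by lia.
  by rewrite lin_lin; congr lin; rewrite /lin -natr1; field.
have -> : (l.+1 %/ 3 = (l %/ 3).+1)%N by lia.
have -> : (l.+1 %% 3 = 0)%N by lia.
by rewrite e mul0r lin0 /lin; field.
Qed.

Definition arc_point (x d : R) (j : nat) (s : R) : R * R :=
  nth (0, 0) [:: (x, lin m%:R (m%:R + d) s); (lin x (p%:R + d) s, m%:R + d);
    (p%:R + d, lin (m%:R + d) (- d) s); (lin (p%:R + d) x s, - d);
    (x, lin (- d) 0 s)] j.

Lemma vpoint_arc (k j : nat) (s : R) : (j < 5)%N ->
  vpoint k (3 * m + j) s = arc_point (posn c m k)%:R (arc_height k) j s.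
Proof.
have lcc (a : R) : lin a a s = a by rewrite /lin; ring.
rewrite /vpoint /vtx.
have -> : ((3 * m + j).+1 <= 3 * m)%N = false by apply/negbTE; lia.
have -> : ((3 * m + j).+1 - (3 * m).+1 = j)%N by lia.
case: j => [_|j j5].
  rewrite addn0 leqnn mulKn// modnMr mul0r lin0 /lin2 /arc_point /= lcc.
  by congr (_, lin _ _ _); rewrite natrM; field.
have -> : (3 * m + j.+1 <= 3 * m)%N = false by apply/negbTE; lia.
have -> : (3 * m + j.+1 - (3 * m).+1 = j)%N by lia.
by case: j j5 => [|[|[|[|//]]]] _; rewrite /lin2 /arc_point /= ?lcc.
Qed.

Lemma vpoint0 (k l : nat) : vpoint k l 0 = vtx k l.
Proof. by rewrite /vpoint /lin2 !lin0 -surjective_pairing. Qed.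

Lemma vpoint1 (k l : nat) : vpoint k l 1 = vtx k l.+1.
Proof. by rewrite /vpoint /lin2 !lin1 -surjective_pairing. Qed.

End Vertices.

(** The arcs closing up two positions are nested: the one of larger x lies
    strictly inside. *)
Lemma arc_meet (R : realType) (p m : nat) (x d x' d' : R) (i j : nat) (s t : R) :
  (0 < m)%N -> 1 <= d -> 1 <= d' -> x + d = p%:R -> x' + d' = p%:R ->
  (i <= j)%N -> (j < 5)%N -> 0 <= s <= 1 -> 0 <= t <= 1 ->
  arc_point p m x d i s = arc_point p m x' d' j t ->
  x = x' /\ ((i = j /\ s = t) \/ [/\ j = i.+1, s = 1 & t = 0]).
Proof.
move=> m0 d1 d1' xd xd' ij j5 /andP[s0 s1] /andP[t0 t1].
have mR : 1 <= m%:R :> R by rewrite ler1n.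
rewrite /arc_point /lin; move: (m%:R) mR => M M1.
have b1 : 0 <= s * d by nra.
have b2 : s * d <= d by nra.
have b3 : 0 <= t * d' by nra.
have b4 : t * d' <= d' by nra.
have b5 : 0 <= s * M by nra.
have b6 : s * M <= M by nra.
have b7 : 0 <= t * M by nra.
have b8 : t * M <= M by nra.
have one (z e : R) : 1 <= e -> z * e = e -> z = 1 by nra.
have zero (z e : R) : 1 <= e -> z * e = 0 -> z = 0 by nra.
case: i ij => [|[|[|[|[|i]]]]]; case: j j5 => [|[|[|[|[|j]]]]] // _ _ /= [e1 e2].
all: have xE : x = p%:R - d by lra.
all: have xE' : x' = p%:R - d' by lra.
all: rewrite {}xE {}xE' in e1 e2 xd xd' *.
all: try by exfalso; lra.
all: have dd : d' = d by lra.
all: rewrite {}dd in e1 e2 b3 b4 d1' xd' *; split => //.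
- by left; split => //; apply/eqP; rewrite -subr_eq0; apply/eqP/(zero _ d) => //; lra.
- by right; split => //; [apply: (one _ d)|apply: (zero _ d)] => //; lra.
- by left; split => //; apply/eqP; rewrite -subr_eq0; apply/eqP/(zero _ d) => //; lra.
- by right; split => //; [apply: (one _ d)|apply: (zero _ (M + 2 * d))] => //; lra.
- by left; split => //; apply/eqP; rewrite -subr_eq0; apply/eqP/(zero _ (M + 2 * d)) => //; lra.
- by right; split => //; [apply: (one _ (M + 2 * d))|apply: (zero _ d)] => //; lra.
- by left; split => //; apply/eqP; rewrite -subr_eq0; apply/eqP/(zero _ d) => //; lra.
- by right; split => //; [apply: (one _ d)|apply: (zero _ d)] => //; lra.
- by left; split => //; apply/eqP; rewrite -subr_eq0; apply/eqP/(zero _ d) => //; lra.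
Qed.

(** Points of two strands with the same projection are at the same level, and
    the arcs, which are nested, touch the strands only where they end. *)
Lemma vpoint_meet (R : realType) (p m : nat) (c : nat -> option nat) (k k' l l' : nat) (s t : R) :
  (0 < m)%N -> (forall u i, c u = Some i -> (i.+1 < p)%N) ->
  (k < p)%N -> (k' < p)%N -> (l <= l')%N -> (l' < 3 * m + 5)%N ->
  0 <= s <= 1 -> 0 <= t <= 1 -> vpoint p m c k l s = vpoint p m c k' l' t ->
  [\/ [/\ k = k', l = l' & s = t],
      [/\ k = k', l' = l.+1, s = 1 & t = 0],
      [/\ k = posn c m k', l = 0%N, l' = (3 * m + 4)%N, s = 0 & t = 1]
    | [/\ l = l', s = 2^-1, t = 2^-1 & exists u i,
        [/\ (u < m)%N, c u = Some i, l = (3 * u).+1 &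
          (posn c u k = i /\ posn c u k' = i.+1) \/
          (posn c u k = i.+1 /\ posn c u k' = i)]]].
Proof.
move=> m0 cp kp kp' ll' l'L s01 t01 e.
have same (r : R) a b : (a < 3 * m)%N -> 0 <= r <= 1 -> a = b -> k <> k' ->
    vpoint p m c k a r = vpoint p m c k' b r ->
    r = 2^-1 /\ exists u i, [/\ (u < m)%N, c u = Some i, a = (3 * u).+1 &
          (posn c u k = i /\ posn c u k' = i.+1) \/
          (posn c u k = i.+1 /\ posn c u k' = i)].
  move=> am r01 <- kk'; rewrite !vpoint_strand// => -[ex].
  have a3 : (a %% 3 < 3)%N by rewrite ltn_mod.
  have [||u2 [i ci h]] := lin_swap_meet _ _ ex.
  - by move/posn_inj.
  - have : (a %% 3)%:R <= 2 :> R by rewrite ler_nat -ltnS.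
    have : 0 <= (a %% 3)%:R :> R by exact: ler0n.
    by clear -r01; lra.
  have a1 : (a %% 3 = 1)%N.
    move: a3 u2; by case: (a %% 3)%N => [|[|[|//]]] //= _ u2; exfalso; clear -r01 u2; lra.
  split; first by move: u2; rewrite a1; clear; lra.
  exists (a %/ 3)%N, i; split => //; last 1 first.
  + by rewrite {1}(divn_eq a 3) a1 addn1 mulnC.
  + by rewrite ltn_divLR// mulnC.
have dP j : (j < p)%N -> 1 <= arc_height p m c j :> R /\ (posn c m j)%:R + arc_height p m c j = p%:R :> R.
  move=> jp; have lt := posn_lt m cp jp; rewrite /arc_height; split.
    by rewrite ler1n subn_gt0.
  by rewrite -natrD subnKC// ltnW.
have [lm'|ml'] := ltnP l' (3 * m).
  have lm : (l < 3 * m)%N by exact: leq_ltn_trans lm'.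
  have el : l%:R + s = l'%:R + t.
    by move: e; rewrite !vpoint_strand// => -[_]; clear; lra.
  have [ll|nll] := eqVneq l l'.
    have st : s = t by move: el; rewrite ll; clear; lra.
    have [kk|kk] := eqVneq k k'; first by apply: Or41.
    rewrite -st -?ll in e *; have [|s2 h] := same s l l lm s01 erefl _ e.
      exact/eqP.
    by apply: Or44; split.
  have lS : (l.+1 <= l')%N by rewrite ltn_neqAle nll.
  have lSR : l%:R + 1 <= l'%:R :> R by rewrite natr1 ler_nat.
  have [s1 t0] : s = 1 /\ t = 0 by clear -el lSR s01 t01; split; lra.
  have lE : l' = l.+1.
    apply/eqP; rewrite -(eqr_nat R) -natr1; apply/eqP.
    by move: el; rewrite s1 t0; clear; lra.
  have [kk|kk] := eqVneq k k'; first by apply: Or42.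
  exfalso; move: e; rewrite s1 vpoint1 -lE -vpoint0 t0 => e.
  have z01 : 0 <= (0 : R) <= 1 by clear; lra.
  have [|/esym/eqP] := same 0 l' l' lm' z01 erefl _ e; first exact/eqP.
  by rewrite invr_eq0 pnatr_eq0.
have [j j5 l'E] : exists2 j, (j < 5)%N & l' = (3 * m + j)%N.
  by exists (l' - 3 * m)%N; lia.
have [d1' xd'] := dP k' kp'.
have [lm|ml] := ltnP l (3 * m); last first.
  have [i i5 lE] : exists2 i, (i < 5)%N & l = (3 * m + i)%N.
    by exists (l - 3 * m)%N; lia.
  have [d1 xd] := dP k kp.
  move: e; rewrite l'E lE !vpoint_arc//.
  have ij : (i <= j)%N by lia.
  move=> /(arc_meet m0 d1 d1' xd xd' ij j5 s01 t01)[/eqP].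
  rewrite eqr_nat => /eqP/posn_inj kk [[-> st]|[-> s1 t0]]; first by apply: Or41.
  by apply: Or42; rewrite addnS.
(* Only the first and the last edge of an arc reach the levels of the strands. *)
have yl : 0 <= (l%:R + s) / 3 <= m%:R.
  have : l%:R + 1 <= 3 * m%:R :> R by rewrite natr1 -natrM ler_nat.
  have : 0 <= l%:R :> R by exact: ler0n.
  by clear -s01; lra.
have xlt a : (posn c a k)%:R + 1 <= p%:R :> R by rewrite natr1 ler_nat posn_lt.
have u01 : 0 <= ((l %% 3)%:R + s) / 3 <= 1.
  have : (l %% 3)%:R <= 2 :> R by rewrite ler_nat -ltnS ltn_mod.
  have : 0 <= (l %% 3)%:R :> R by exact: ler0n.
  by clear -s01; lra.
have xl : lin (posn c (l %/ 3) k)%:R (posn c (l %/ 3).+1 k)%:R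
    (((l %% 3)%:R + s) / 3) < p%:R.
  have h1 := xlt (l %/ 3)%N; have h2 := xlt (l %/ 3).+1.
  by move: h1 h2 u01; move: (_ / 3) (posn _ _ _)%:R (posn _ _ _)%:R;
    clear => u a b h1 h2 u01; rewrite /lin; nra.
have mR : 1 <= m%:R :> R by rewrite ler1n.
have e' := e; rewrite vpoint_strand// l'E vpoint_arc// in e'.
have := congr1 snd e'; have := congr1 fst e'; rewrite /arc_point => {e'}.
case: j j5 l'E => [|[|[|[|[|//]]]]] _ l'E /= e1 e2.
- rewrite addn0 in l'E; have t0 : t = 0.
    by move: e2; rewrite /lin => e2; clear -e2 yl d1' t01 mR; nra.
  have es : (l%:R + s) / 3 = m%:R by rewrite e2 t0 lin0.
  have lE : l.+1 = (3 * m)%N.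
    apply/eqP; rewrite eqn_leq lm -(ler_nat R) natrM.
    by clear -es s01; rewrite -natr1; lra.
  have s1 : s = 1.
    have : l%:R + 1 = 3 * m%:R :> R by rewrite natr1 -natrM lE.
    by clear -es; lra.
  apply: Or42; split => //; last by rewrite l'E lE.
  move: e; rewrite s1 t0 vpoint1 vpoint0 /vtx lE l'E leqnn mulKn// modnMr mul0r !lin0.
  by move=> [/eqP]; rewrite eqr_nat => /eqP/posn_inj.
- by exfalso; clear -e2 yl d1'; lra.
- by exfalso; clear -e1 xl d1'; lra.
- by exfalso; clear -e2 yl d1'; lra.
- have t1 : t = 1.
    by move: e2; rewrite /lin => e2; clear -e2 yl d1' t01 mR; nra.
  have es : (l%:R + s) / 3 = 0 by rewrite e2 t1 lin1.
  have lE : l = 0%N.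
    apply/eqP; rewrite -(eqr_nat R); apply/eqP.
    by have : 0 <= l%:R :> R; [exact: ler0n|clear -es s01; lra].
  have s0 : s = 0 by move: es; rewrite lE; clear; lra.
  apply: Or43; split => //.
  move: e1; rewrite lE s0 div0n mod0n addr0 mul0r lin0 => /eqP.
  by rewrite eqr_nat => /eqP.
Qed.

Lemma swap_at_l (k : nat) : swap_at (Some k) k = k.+1.
Proof. by rewrite /swap_at eqxx. Qed.

Lemma swap_at_r (k : nat) : swap_at (Some k) k.+1 = k.
Proof. by rewrite /swap_at eqxx eqn_leq ltnn. Qed.

Lemma posnS (c : nat -> option nat) (t k : nat) :
  posn c t.+1 k = swap_at (c t) (posn c t k).
Proof. by []. Qed.

(** The closure is connected: st a is the position at level 0 of the strand
    followed in the a-th turn, and all positions occur. *)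
Record closed_braid (p m : nat) (c : nat -> option nat) (st : nat -> nat) : Prop :=
  ClosedBraid {
    braid_gt0 : (0 < m)%N;
    strands_gt0 : (0 < p)%N;
    braid_letter : forall t i, c t = Some i -> (i.+1 < p)%N;
    st_lt : forall a, (st a < p)%N;
    st_inj : forall a b, (a < p)%N -> (b < p)%N -> st a = st b -> a = b;
    st_next : forall a, st a.+1 = posn c m (st a);
    st_period : st p = st 0%N }.

Definition turn_size (m : nat) : nat := (3 * m + 5)%N.

Definition braid_plan (R : realType) (p m : nat) (c : nat -> option nat)
    (st : nat -> nat) (i : 'I_(p * turn_size m)) : R * R :=
  vtx p m c (st (i %/ turn_size m)%N) (i %% turn_size m)%N.

Arguments braid_plan R p m c st i : clear implicits.

Definition braid_cross (p m : nat) (c : nat -> option nat) (st : nat -> nat)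
    (i j : 'I_(p * turn_size m)) : Prop :=
  exists t k, [/\ (t < m)%N, c t = Some k,
    (i %% turn_size m = (3 * t).+1)%N, (j %% turn_size m = (3 * t).+1)%N &
    let x := posn c t (st (i %/ turn_size m)%N) in
    let y := posn c t (st (j %/ turn_size m)%N) in
    (x = k /\ y = k.+1) \/ (x = k.+1 /\ y = k)].

Arguments braid_cross p m c st i j : clear implicits.

Lemma turn_size_gt0 (m : nat) : (0 < turn_size m)%N.
Proof. by rewrite /turn_size addn_gt0 orbT. Qed.

(** The vertices and heights of the closed polygon are functions f of the turn and
    of the place in the turn; edges can then be described without treating the
    last edge of a turn apart. *)
Lemma ordS_turn (T : Type) (p L : nat) (f : nat -> nat -> T) (i : 'I_(p * L)) :
  (0 < L)%N -> (forall a, f a L = f a.+1 0%N) -> f p 0%N = f 0%N 0%N ->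
  f (ordS i %/ L)%N (ordS i %% L)%N = f (i %/ L)%N (i %% L).+1.
Proof.
move=> L0 fL fp; have ip := ltn_ord i; have := ltn_mod i L; rewrite L0.
have aL : (i %/ L < p)%N by rewrite ltn_divLR.
move: aL; set a := (i %/ L)%N; set l := (i %% L)%N => aL lL.
have iE : nat_of_ord i = (a * L + l)%N by exact: divn_eq.
have vS : nat_of_ord (ordS i) = (i.+1 %% (p * L))%N by [].
have [lS|lS] := ltnP l.+1 L.
  have -> : nat_of_ord (ordS i) = (a * L + l.+1)%N.
    have : (a.+1 * L <= p * L)%N by rewrite leq_mul2r aL orbT.
    by rewrite mulSn vS => ?; rewrite modn_small iE; lia.
  by rewrite divnMDl// divn_small// addn0 modnMDl modn_small.
have lE : l.+1 = L by apply/eqP; rewrite eqn_leq lL.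
have SE : i.+1 = (a.+1 * L)%N by rewrite iE -addnS lE mulSn addnC.
rewrite lE fL; have [aS|aS] := ltnP a.+1 p.
  have -> : nat_of_ord (ordS i) = (a.+1 * L)%N.
    by rewrite vS SE modn_small// ltn_pmul2r.
  by rewrite mulnK// modnMl.
have aE : a.+1 = p by apply/eqP; rewrite eqn_leq aL.
have -> : nat_of_ord (ordS i) = 0%N by rewrite vS SE aE modnn.
by rewrite div0n mod0n aE fp.
Qed.

Lemma vtx_turn (R : realType) (p m : nat) (c : nat -> option nat) (k : nat) :
  vtx p m c k (turn_size m) = vtx p m c (posn c m k) 0 :> R * R.
Proof.
rewrite /vtx /turn_size /=.
have -> : (3 * m + 5 <= 3 * m)%N = false by apply/negbTE; lia.
have -> : (3 * m + 5 - (3 * m).+1 = 4)%N by lia.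
by rewrite /= div0n mod0n !mul0r lin0.
Qed.

Lemma braid_plan_ordS (R : realType) (p m : nat) (c : nat -> option nat)
    (st : nat -> nat) (i : 'I_(p * turn_size m)) : closed_braid p m c st ->
  braid_plan R p m c st (ordS i) =
  vtx p m c (st (i %/ turn_size m)%N) (i %% turn_size m).+1.
Proof.
move=> cb; apply: (ordS_turn (f := fun a l => vtx p m c (st a) l)).
- exact: turn_size_gt0.
- by move=> a; rewrite vtx_turn (st_next cb).
- by rewrite (st_period cb).
Qed.

Lemma turn_index_inj (p m : nat) (i j : 'I_(p * turn_size m)) :
  (i %/ turn_size m = j %/ turn_size m)%N ->
  (i %% turn_size m = j %% turn_size m)%N -> i = j.
Proof.
move=> e1 e2; apply/val_inj.
by rewrite /= (divn_eq i (turn_size m)) (divn_eq j (turn_size m)) e1 e2.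
Qed.

Lemma turn_lt (p m : nat) (i : 'I_(p * turn_size m)) : (i %/ turn_size m < p)%N.
Proof. by rewrite ltn_divLR ?turn_size_gt0. Qed.

Lemma braid_shadow (R : realType) (p m : nat) (c : nat -> option nat)
    (st : nat -> nat) : closed_braid p m c st ->
  shadow (braid_plan R p m c st) (braid_cross p m c st).
Proof.
move=> cb; have p0 := strands_gt0 cb; have m0 := braid_gt0 cb.
have L5 : (5 <= turn_size m)%N by rewrite /turn_size leq_addl.
have pt (i : 'I_(p * turn_size m)) s : lin2 (braid_plan R p m c st i) (braid_plan R p m c st (ordS i)) s =
    vpoint p m c (st (i %/ turn_size m)%N) (i %% turn_size m)%N s.
  by rewrite braid_plan_ordS.
split.
- by apply: leq_trans (leq_pmull _ p0); apply: leq_trans L5.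
- move=> i j [t [k [tm ct it jt h]]]; exists t, k; split => //.
  by case: h => /= h; [right|left]; tauto.
- move=> i j j' [t [k [tm ct it jt h]]] [t' [k' [tm' ct' it' jt' h']]].
  have tt : t = t' by lia.
  rewrite -{}tt in ct' jt' h' *; apply: turn_index_inj; last by rewrite jt jt'.
  apply: (st_inj cb); rewrite ?turn_lt//; apply: (@posn_inj c t).
  by move: h h' ct' => /= h h'; rewrite ct => -[kk]; lia.
- by move=> i j [t [k [_ _ _ _ /= h]]] e; rewrite e in h; lia.
- move=> i j [t [k [tm ct it jt /= h]]]; rewrite !pt it jt.
  have lt : ((3 * t).+1 < 3 * m)%N by lia.
  rewrite !vpoint_strand//.
  have -> : ((3 * t).+1 %/ 3 = t)%N by lia.
  have -> : ((3 * t).+1 %% 3 = 1)%N by lia.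
  congr pair; rewrite !posnS ct.
  by case: h => -[-> ->]; rewrite swap_at_l swap_at_r /lin -natr1; lra.
move=> i j s t s01 t01; rewrite !pt.
wlog ij : i j s t s01 t01 / (i %% turn_size m <= j %% turn_size m)%N.
  move=> H e; have [le|/ltnW le] := leqP (i %% turn_size m) (j %% turn_size m).
    exact: H.
  case: (H _ _ _ _ t01 s01 le (esym e)) => [[[-> ->]|[-> -> ->]|[-> -> ->]]|[cji -> ->]].
  - by left; apply: Or31.
  - by left; apply: Or33.
  - by left; apply: Or32.
  right; split => //; case: cji => u [k [um cu hi hj h]]; exists u, k; split => //.
  by case: h => /= h; [right|left]; tauto.
move=> e; have lL : (j %% turn_size m < 3 * m + 5)%N by rewrite ltn_mod turn_size_gt0.
have stp a := st_lt cb a.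
case: (vpoint_meet m0 (@braid_letter _ _ _ _ cb) (stp _) (stp _) ij lL s01 t01 e).
- move=> [kk ll ->]; left; apply: Or31; split => //.
  by apply: turn_index_inj => //; exact: (st_inj cb (turn_lt i) (turn_lt j) kk).
- move=> [kk ll -> ->]; left; apply: Or32; split => //.
  have {}kk := st_inj cb (turn_lt i) (turn_lt j) kk.
  apply: val_inj => /=; rewrite modn_small.
    by rewrite (divn_eq i (turn_size m)) (divn_eq j (turn_size m)) kk ll addnS.
  rewrite (divn_eq i (turn_size m)) -addnS -ll kk -divn_eq.
  exact: ltn_ord.
- move=> [/esym kk l0 l4 -> ->]; left; apply: Or33; split => //.
  rewrite -(st_next cb) in kk.
  have jL : (j %% turn_size m).+1 = turn_size m by rewrite l4 /turn_size; lia.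
  have jp := turn_lt j.
  have jE : j.+1 = ((j %/ turn_size m).+1 * turn_size m)%N.
    by rewrite {1}(divn_eq j (turn_size m)) -addnS jL mulSn addnC.
  apply/val_inj => /=; rewrite jE.
  have [jS|jS] := ltnP (j %/ turn_size m).+1 p.
    have := st_inj cb jS (turn_lt i) kk => e'.
    rewrite modn_small ?ltn_pmul2r ?turn_size_gt0// e'.
    by rewrite {1}(divn_eq i (turn_size m)) l0 addn0.
  have jpE : (j %/ turn_size m).+1 = p by apply/eqP; rewrite eqn_leq jp.
  rewrite jpE modnn; rewrite jpE (st_period cb) in kk.
  have := st_inj cb p0 (turn_lt i) kk => e'.
  by rewrite (divn_eq i (turn_size m)) l0 addn0 -e'.
- move=> [ll s2 t2 [u [k [um cu lu h]]]]; right; split => //.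
  by exists u, k; split => //; rewrite -ll.
Qed.

(** * Braid words and crossing changes *)

(** Of the four vertices of a strand between two levels, the two inner ones are
    off the plane of height 0 if the strand goes to the right. *)
Definition bump_height (R : realType) (m : nat) (c : nat -> option nat) (sgn : nat -> bool)
    (k l : nat) : R :=
  if [&& (l < 3 * m)%N, (l %% 3 != 0)%N & c (l %/ 3)%N == Some (posn c (l %/ 3) k)]
  then if sgn (l %/ 3)%N then 1 else -1 else 0.

Arguments bump_height R m c sgn k l : clear implicits.

Definition turn_heights (R : realType) (p m : nat) (st : nat -> nat)
    (f : nat -> nat -> R) (i : 'I_(p * turn_size m)) : R :=
  f (st (i %/ turn_size m)%N) (i %% turn_size m)%N.

Arguments turn_heights {R} p m st f i.

Definition braid_polygon (R : realType) (p m : nat) (c : nat -> option nat)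
    (st : nat -> nat) (sgn : nat -> bool) : 'I_(p * turn_size m) -> R3 R :=
  at_heights (braid_plan R p m c st) (turn_heights p m st (bump_height R m c sgn)).

Arguments braid_polygon R p m c st sgn : clear implicits.

Lemma turn_heights_ordS (R : realType) (p m : nat) (c : nat -> option nat)
    (st : nat -> nat) (f : nat -> nat -> R) (i : 'I_(p * turn_size m)) :
  closed_braid p m c st -> (forall k, f k (turn_size m) = f (posn c m k) 0%N) ->
  turn_heights p m st f (ordS i) =
  f (st (i %/ turn_size m)%N) (i %% turn_size m).+1.
Proof.
move=> cb ff; apply: (ordS_turn (f := fun a l => f (st a) l)).
- exact: turn_size_gt0.
- by move=> a; rewrite ff (st_next cb).
- by rewrite (st_period cb).
Qed.

Lemma bump_turn (R : realType) (m : nat) (c : nat -> option nat)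
    (sgn : nat -> bool) (k : nat) :
  bump_height R m c sgn k (turn_size m) = bump_height R m c sgn (posn c m k) 0.
Proof.
rewrite /bump_height /turn_size mod0n andbF.
by have -> : (3 * m + 5 < 3 * m)%N = false by apply/negbTE; lia.
Qed.

Lemma index_lt (p a l L : nat) : (a < p)%N -> (l < L)%N -> (a * L + l < p * L)%N.
Proof.
move=> ap lL; have : (a.+1 * L <= p * L)%N by rewrite leq_mul2r ap orbT.
by rewrite mulSn; lia.
Qed.

Lemma turn_index (p m a l : nat) : (a < p)%N -> (l < turn_size m)%N ->
  exists i : 'I_(p * turn_size m),
    (i %/ turn_size m = a)%N /\ (i %% turn_size m = l)%N.
Proof.
move=> ap lL; exists (Ordinal (index_lt ap lL)) => /=.
by rewrite divnMDl ?turn_size_gt0// divn_small// addn0 modnMDl modn_small.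
Qed.

Lemma inj_surj_lt (p : nat) (f : nat -> nat) :
  (forall a, (a < p)%N -> (f a < p)%N) ->
  (forall a b, (a < p)%N -> (b < p)%N -> f a = f b -> a = b) ->
  forall k, (k < p)%N -> exists2 a, (a < p)%N & f a = k.
Proof.
move=> flt finj k kp; pose g (i : 'I_p) := Ordinal (flt i (ltn_ord i)).
have ginj : injective g by move=> i j [] /finj ij; apply/val_inj/ij.
have [h _ hK] := injF_bij ginj.
exists (h (Ordinal kp)) => //.
by have := congr1 val (hK (Ordinal kp)).
Qed.

Lemma closed_braid_surj (p m : nat) (c : nat -> option nat) (st : nat -> nat)
    (t k : nat) : closed_braid p m c st -> (k < p)%N ->
  exists2 a, (a < p)%N & posn c t (st a) = k.
Proof.
move=> cb; apply: inj_surj_lt => [a _|a b ap bp /posn_inj]; last exact: (st_inj cb).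
apply: posn_lt (st_lt cb a); exact: (@braid_letter _ _ _ _ cb).
Qed.

Lemma strandP (R : realType) (i : nat) (b : bool) (t k : nat) (x : R3 R) :
  polyline (strand R i b t k) x <->
  exists u s, [/\ (u < 3)%N, 0 <= s <= 1 &
    x = ((lin k%:R (swap_at (Some i) k)%:R ((u%:R + s) / 3), t%:R + (u%:R + s) / 3),
         if k == i then lin (if u != 0%N then if b then 1 else -1 else 0)
                            (if u != 2%N then if b then 1 else -1 else 0) s
         else 0)].
Proof.
rewrite /polyline /strand /swap_at; case: (k =P i) => [->|ki].
  rewrite -natr1; split => [[u us [s s01 ->]]|[u [s [u3 s01 ->]]]].
    exists u, s; split => //; move: u us => [|[|[|//]]] _;
    by rewrite segmentE /= /lin2 /lin /=; congr (_, _, _); field.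
  exists u => //; exists s => //; move: u u3 => [|[|[|//]]] _;
  by rewrite segmentE /= /lin2 /lin /=; congr (_, _, _); field.
have thirds s : 0 <= s <= 1 ->
    exists u s', [/\ (u < 3)%N, 0 <= s' <= 1 & s = (u%:R + s') / 3 :> R].
  move=> s01; have [|u [s' [u3 s'01 e]]] := @split_integer_part R 3 (3 * s) isT.
    by clear -s01; lra.
  by exists u, s'; split => //; rewrite -e; field.
have third u (s' : R) : (u < 3)%N -> 0 <= s' <= 1 -> 0 <= (u%:R + s') / 3 <= 1.
  by move=> u3 h; move: u u3 => [|[|[|//]]] _; clear -h; lra.
case: (k =P i.+1) => [->|ki'].
  rewrite -natr1; split => [[[|//] _ [s /thirds[u [s' [u3 s01 ->]]] ->]]|[u [s [u3 s01 ->]]]].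
    exists u, s'; split => //; rewrite segmentE /= /lin2 /lin /=.
    by congr (_, _, _); field.
  exists 0%N => //; exists ((u%:R + s) / 3); first exact: third.
  by rewrite segmentE /= /lin2 /lin /=; congr (_, _, _); field.
split => [[[|//] _ [s /thirds[u [s' [u3 s01 ->]]] ->]]|[u [s [u3 s01 ->]]]].
  exists u, s'; split => //; rewrite segmentE /= /lin2 /lin /=.
  by congr (_, _, _); field.
exists 0%N => //; exists ((u%:R + s) / 3); first exact: third.
by rewrite segmentE /= /lin2 /lin /=; congr (_, _, _); field.
Qed.

Lemma closing_arcP (R : realType) (p m k : nat) (x : R3 R) :
  polyline (closing_arc R p m k) x <->
  exists j s, [/\ (j < 5)%N, 0 <= s <= 1 &
    x = (arc_point p m k%:R (p - k)%:R j s, 0)].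
Proof.
split => [[j jS [s s01 ->]]|[j [s [j5 s01 ->]]]].
  exists j, s; split => //; rewrite segmentE.
  by case: j jS => [|[|[|[|[|//]]]]] _; rewrite /= /arc_point /lin2 /lin /=;
    congr (_, _, _); ring.
exists j => //; exists s => //; rewrite segmentE.
by case: j j5 => [|[|[|[|[|//]]]]] _; rewrite /= /arc_point /lin2 /lin /=;
  congr (_, _, _); ring.
Qed.

Definition cyclic_word (p : nat) (p1 : (0 < p.-1)%N) (m : nat) (sgn : nat -> bool) :
    braid_word p :=
  [seq (Ordinal (ltn_pmod t p1), sgn t) | t <- iota 0 m].

Definition cyclic_letter (p t : nat) : option nat := Some (t %% p.-1)%N.

Lemma size_cyclic_word (p : nat) (p1 : (0 < p.-1)%N) (m : nat) (sgn : nat -> bool) :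
  size (cyclic_word p1 m sgn) = m.
Proof. by rewrite size_map size_iota. Qed.

Lemma braid_polygon_edge (R : realType) (p m : nat) (c : nat -> option nat)
    (st : nat -> nat) (sgn : nat -> bool) (i : 'I_(p * turn_size m)) (s : R) :
  closed_braid p m c st ->
  let k := st (i %/ turn_size m)%N in let l := (i %% turn_size m)%N in
  (1 - s) *: braid_polygon R p m c st sgn i +
    s *: braid_polygon R p m c st sgn (ordS i) =
  (vpoint p m c k l s, lin (bump_height R m c sgn k l) (bump_height R m c sgn k l.+1) s).
Proof.
move=> cb k l; rewrite segmentE /=; congr pair; first by rewrite braid_plan_ordS.
by rewrite (turn_heights_ordS _ cb)//; exact: bump_turn.
Qed.

Lemma braid_closure_polygon (R : realType) (p m : nat) (p1 : (0 < p.-1)%N)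
    (st : nat -> nat) (sgn : nat -> bool) :
  closed_braid p m (cyclic_letter p) st ->
  braid_closure R (cyclic_word p1 m sgn) =
  polygon (braid_polygon R p m (cyclic_letter p) st sgn).
Proof.
move=> cb; set c := cyclic_letter p.
have ptE t k u s : (t < m)%N -> (u < 3)%N ->
    (vpoint p m c k (3 * t + u) s,
      lin (bump_height R m c sgn k (3 * t + u)) (bump_height R m c sgn k (3 * t + u).+1) s) =
    ((lin (posn c t k)%:R (swap_at (c t) (posn c t k))%:R ((u%:R + s) / 3),
      t%:R + (u%:R + s) / 3),
     if posn c t k == (t %% p.-1)%N then
      lin (if u != 0%N then if sgn t then 1 else -1 else 0)
          (if u != 2%N then if sgn t then 1 else -1 else 0) s
     else 0).
  move=> tm u3; have lm : (3 * t + u < 3 * m)%N by lia.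
  rewrite vpoint_strand//.
  have d0 : ((3 * t + u) %/ 3 = t)%N by lia.
  have m0 : ((3 * t + u) %% 3 = u)%N by lia.
  rewrite d0 m0; congr (_, _, _); first by rewrite natrD natrM; field.
  rewrite /bump_height lm d0 m0 /=.
  rewrite [c t == _](_ : _ = (posn c t k == t %% p.-1)%N); last first.
    by rewrite /c /cyclic_letter; apply/eqP/eqP => [[->]|->].
  have [u2|u2] := eqVneq u 2%N.
    have -> : ((3 * t + u).+1 %% 3 = 0)%N by lia.
    rewrite u2 /= !andbF /=.
    by case: (posn c t k == _) => /=; rewrite /lin; ring.
  have -> : ((3 * t + u).+1 %% 3 = u.+1)%N by lia.
  have -> : ((3 * t + u).+1 %/ 3 = t)%N by lia.
  have -> : ((3 * t + u).+1 < 3 * m)%N by lia.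
  rewrite [c t == _](_ : _ = (posn c t k == t %% p.-1)%N) /=; last first.
    by rewrite /c /cyclic_letter; apply/eqP/eqP => [[->]|->].
  by case: (posn c t k == _) => /=; rewrite ?andbT ?andbF //= /lin; ring.
have arcE k j s : (j < 5)%N ->
    (vpoint p m c k (3 * m + j) s,
      lin (bump_height R m c sgn k (3 * m + j)) (bump_height R m c sgn k (3 * m + j).+1) s) =
    (arc_point p m (posn c m k)%:R (p - posn c m k)%:R j s, 0).
  move=> j5; rewrite vpoint_arc//; congr pair; rewrite /bump_height.
  have -> : (3 * m + j < 3 * m)%N = false by apply/negbTE; lia.
  have -> : ((3 * m + j).+1 < 3 * m)%N = false by apply/negbTE; lia.
  by rewrite /lin /=; ring.
have sz := size_cyclic_word p1 m sgn.
have tnthE (t : 'I_(size (cyclic_word p1 m sgn))) :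
    tnth (in_tuple (cyclic_word p1 m sgn)) t = (Ordinal (ltn_pmod t p1), sgn t).
  have tm : (t < m)%N by rewrite -{2}sz.
  rewrite (tnth_nth (Ordinal p1, true)) /= (nth_map 0%N) ?size_iota//.
  by rewrite nth_iota// add0n.
apply/seteqP; split => x.
  case=> [[t [k]]|[k]].
    rewrite tnthE /= => /strandP[u [s [u3 s01 ->]]].
    have tm : (t < m)%N by rewrite -{2}sz.
    have [a ap ak] := closed_braid_surj t cb (ltn_ord k).
    have [|i [ia il]] := @turn_index p m a (3 * t + u) ap.
      by rewrite /turn_size; lia.
    exists i, s => //; rewrite braid_polygon_edge// ia il ptE//.
    by rewrite -/c in ak; rewrite ak.
  rewrite sz => /closing_arcP[j [s [j5 s01 ->]]].
  have [a ap ak] := closed_braid_surj m cb (ltn_ord k).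
  have [|i [ia il]] := @turn_index p m a (3 * m + j) ap.
    by rewrite /turn_size; lia.
  exists i, s => //; rewrite braid_polygon_edge// ia il arcE//.
  by rewrite -/c in ak; rewrite ak.
move=> [i [s s01 ->]]; rewrite braid_polygon_edge//.
set k := st _; set l := (i %% _)%N.
have lL : (l < turn_size m)%N by rewrite ltn_mod turn_size_gt0.
have pk t : (posn c t k < p)%N.
  by apply: posn_lt (st_lt cb _); exact: (@braid_letter _ _ _ _ cb).
have [lm|ml] := ltnP l (3 * m).
  have tm : (l %/ 3 < m)%N by rewrite ltn_divLR// mulnC.
  have lE : l = (3 * (l %/ 3) + l %% 3)%N by rewrite {1}(divn_eq l 3) mulnC.
  have u3 : (l %% 3 < 3)%N by rewrite ltn_mod.
  left; have tw : (l %/ 3 < size (cyclic_word p1 m sgn))%N by rewrite sz.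
  exists (Ordinal tw), (Ordinal (pk (l %/ 3)%N)).
  rewrite tnthE /=; apply/strandP; exists (l %% 3)%N, s; split => //.
  by have := ptE _ k _ s tm u3; rewrite -lE.
right; exists (Ordinal (pk m)); rewrite sz; apply/closing_arcP.
exists (l - 3 * m)%N, s; split => //; first by rewrite /turn_size in lL; lia.
by rewrite -arcE ?subnKC//; rewrite /turn_size in lL; lia.
Qed.

Lemma bump_midpoint (R : realType) (p m : nat) (c : nat -> option nat)
    (st : nat -> nat) (sgn : nat -> bool) (i : 'I_(p * turn_size m)) (t : nat) :
  closed_braid p m c st -> (t < m)%N -> (i %% turn_size m = (3 * t).+1)%N ->
  midpoint (turn_heights p m st (bump_height R m c sgn)) i =
  if c t == Some (posn c t (st (i %/ turn_size m)%N))
  then if sgn t then 1 else -1 else 0.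
Proof.
move=> cb tm it; rewrite /midpoint (turn_heights_ordS _ cb); last exact: bump_turn.
rewrite /turn_heights it /bump_height.
have -> : ((3 * t).+1 < 3 * m)%N by lia.
have -> : ((3 * t).+2 < 3 * m)%N by lia.
have -> : ((3 * t).+1 %/ 3 = t)%N by lia.
have -> : ((3 * t).+2 %/ 3 = t)%N by lia.
have -> : ((3 * t).+1 %% 3 = 1)%N by lia.
have -> : ((3 * t).+2 %% 3 = 2)%N by lia.
by rewrite /= /lin; field.
Qed.

Lemma braid_crossP (R : realType) (p m : nat) (c : nat -> option nat)
    (st : nat -> nat) (sgn : nat -> bool) (i j : 'I_(p * turn_size m)) :
  closed_braid p m c st -> braid_cross p m c st i j ->
  exists t, [/\ (t < m)%N, (i %% turn_size m = (3 * t).+1)%N,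
    (j %% turn_size m = (3 * t).+1)%N &
    let z := midpoint (turn_heights p m st (bump_height R m c sgn)) in
    [/\ c t = Some (posn c t (st (i %/ turn_size m)%N)),
        z i = (if sgn t then 1 else -1) & z j = 0] \/
    [/\ c t = Some (posn c t (st (j %/ turn_size m)%N)),
        z i = 0 & z j = (if sgn t then 1 else -1)]].
Proof.
move=> cb [t [k [tm ct it jt /= h]]]; exists t; split => //=.
rewrite !(bump_midpoint _ _ cb tm)// ct.
case: h => -[-> ->]; rewrite eqxx; [left|right]; split => //;
  by case: eqP => // -[]; lia.
Qed.

Lemma braid_cross_unique (p m : nat) (c : nat -> option nat) (st : nat -> nat)
    (i j i' j' : 'I_(p * turn_size m)) :
  closed_braid p m c st -> braid_cross p m c st i j -> braid_cross p m c st i' j' ->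
  (i %% turn_size m = i' %% turn_size m)%N ->
  (i' = i /\ j' = j) \/ (i' = j /\ j' = i).
Proof.
move=> cb [t [k [tm ct it jt /= h]]] [t' [k' [tm' ct' it' jt' /= h']]] ii.
have tt : t' = t by lia.
rewrite {}tt in ct' it' jt' h' tm'; move: ct'; rewrite ct => -[kk].
rewrite -{}kk in h'.
have same (x y : 'I_(p * turn_size m)) : posn c t (st (x %/ turn_size m)%N) =
    posn c t (st (y %/ turn_size m)%N) ->
    (x %% turn_size m = (3 * t).+1)%N -> (y %% turn_size m = (3 * t).+1)%N ->
    x = y.
  move=> /posn_inj/(st_inj cb (turn_lt x) (turn_lt y)) xy xt yt.
  by apply: turn_index_inj => //; rewrite xt yt.
by case: h h' => -[h1 h2] [] [h1' h2'];
  [left|right|right|left]; split; apply: same => //; rewrite ?h1 ?h2 ?h1' ?h2'.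
Qed.

(** Flipping a letter moves the strand going to the right from one side of the
    other strand, which stays at height 0, to the other side. *)
Lemma crossing_flip (R : realType) (p m : nat) (c : nat -> option nat)
    (st : nat -> nat) (sgn sgn' : nat -> bool) (t0 : nat) :
  closed_braid p m c st -> (t0 < m)%N -> c t0 <> None ->
  sgn t0 != sgn' t0 -> (forall t, t != t0 -> sgn t = sgn' t) ->
  crossing_change (braid_polygon R p m c st sgn) (braid_polygon R p m c st sgn').
Proof.
move=> cb tm ct s0 sE.
wlog st0 : sgn sgn' s0 sE / sgn t0.
  move=> H; have [|/negbTE st0] := boolP (sgn t0); first exact: H.
  have [v' v reg vv' [i [j [vij vji rest]]]] : crossing_change
      (braid_polygon R p m c st sgn') (braid_polygon R p m c st sgn).
    apply: H; first by rewrite eq_sym.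
      by move=> t tt; rewrite sE.
    by move: s0; rewrite st0; case: (sgn' t0).
  have sh := braid_shadow R cb.
  split => //; first exact: (shadow_regular _ sh).
  exists j, i; split => // k l kl kl'; split => h; apply/rest => //.
have st0' : sgn' t0 = false by move: s0; rewrite st0; case: (sgn' t0).
have sh := braid_shadow R cb.
have neq s : forall k l, braid_cross p m c st k l ->
    midpoint (turn_heights p m st (bump_height R m c s)) k <>
    midpoint (turn_heights p m st (bump_height R m c s)) l.
  move=> k l /(braid_crossP R s cb)[t [_ _ _ /= [[_ -> ->]|[_ -> ->]]]].
    by case: (s t) => /eqP; rewrite ?oppr_eq0 oner_eq0.
  by case: (s t) => /esym/eqP; rewrite ?oppr_eq0 oner_eq0.
case ck: (c t0) ct => [k|//] _.
have kp := braid_letter cb ck.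
have [a ap ak] := closed_braid_surj t0 cb (ltnW kp).
have [b bp bk] := closed_braid_surj t0 cb kp.
have lL : ((3 * t0).+1 < turn_size m)%N by rewrite /turn_size; lia.
have [i [ia il]] := turn_index ap lL.
have [j [jb jl]] := turn_index bp lL.
have cij : braid_cross p m c st i j.
  by exists t0, k; split => //=; rewrite ia jb ak bk; left.
have mid s : midpoint (turn_heights p m st (bump_height R m c s)) i =
      (if s t0 then 1 else -1) /\
    midpoint (turn_heights p m st (bump_height R m c s)) j = 0.
  rewrite !(bump_midpoint _ _ cb tm)// ia jb ak bk ck eqxx; split => //.
  by case: eqP => // -[]; lia.
apply: (shadow_crossing_change (i := i) (j := j) sh); try exact: neq.
- exact: cij.
- by have [-> ->] := mid sgn; rewrite st0 ltr01.
- by have [-> ->] := mid sgn'; rewrite st0' ltrN10.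
move=> k' l' ckl kl kl'.
have [t [k'' [tm' ct k't l't h]]] := ckl.
have tt : t != t0.
  apply/negP => /eqP tt; rewrite {}tt in k't.
  have [] := braid_cross_unique cb cij ckl _; first by rewrite il k't.
    by move=> [ki lj]; rewrite ki lj eqxx in kl.
  by move=> [kj li]; rewrite kj li eqxx in kl'.
by rewrite !(bump_midpoint _ _ cb tm' k't) !(bump_midpoint _ _ cb tm' l't) sE.
Qed.

(** The successive polygons have the same projection, so that the isotopies
    between the crossing changes are trivial. *)
Lemma unknotted_by_flips (R : realType) (p m : nat) (c : nat -> option nat)
    (st : nat -> nat) (sgn sgn' : nat -> bool) :
  closed_braid p m c st -> (forall t, (t < m)%N -> c t <> None) ->
  trivial_knot (polygon (braid_polygon R p m c st sgn')) ->
  unknotted_by #|[set t : 'I_m | sgn t != sgn' t]%SET|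
    (polygon (braid_polygon R p m c st sgn)).
Proof.
move=> cb cc triv.
move D : #|_| => d; elim: d => [|d IH] in sgn D *.
  suff -> : braid_polygon R p m c st sgn = braid_polygon R p m c st sgn' by [].
  apply/funext => i; rewrite /braid_polygon /at_heights /turn_heights /bump_height.
  case: ifP => // /and3P[lm _ _].
  have tm : (i %% turn_size m %/ 3 < m)%N by rewrite ltn_divLR// [(m * 3)%N]mulnC.
  have : Ordinal tm \notin [set t : 'I_m | sgn t != sgn' t]%SET.
    by rewrite (cards0_eq D) inE.
  by rewrite inE negbK /= => /eqP ->.
have /card_gt0P[t0 t0D] : (0 < #|[set t : 'I_m | sgn t != sgn' t]%SET|)%N by rewrite D.
rewrite inE in t0D.
pose sgn1 t := if t == t0 :> nat then sgn' t else sgn t.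
exists (p * turn_size m)%N, (braid_polygon R p m c st sgn),
  (braid_polygon R p m c st sgn1); split.
- exact/isotopic_ambient/isotopic_refl.
- apply: (@crossing_flip R p m c st sgn sgn1 t0) => //; first exact: cc.
    by rewrite /sgn1 eqxx.
  by move=> t /negbTE tt; rewrite /sgn1 tt.
apply: IH; apply/eqP; rewrite -eqSS -D (cardsD1 t0 [set t : 'I_m | sgn t != sgn' t]%SET).
rewrite inE t0D add1n eqSS; apply/eqP; congr (#|pred_of_set _|).
apply/setP => t; rewrite !inE /sgn1 -val_eqE /=.
by case: (t =P t0 :> nat) => [->|]; rewrite ?eqxx.
Qed.

(** * Unknotting a layered closed braid *)

Definition hat (R : realType) (x : R) : R :=
  Num.max 0 (Num.min (1 - 2 * x) (1 + 2 * x)).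

Lemma cts_hat (R : realType) (T : topologicalType) (f : T -> R) :
  cts f -> cts (fun x => hat (f x)).
Proof. by move=> cf; rewrite /hat; cts_auto. Qed.

Lemma hat0 (R : realType) : hat (0 : R) = 1.
Proof. by rewrite /hat mulr0 subr0 addr0 minxx max_r. Qed.

Lemma hat_ge0 (R : realType) (x : R) : 0 <= hat x.
Proof. by rewrite /hat le_max lexx. Qed.

Lemma hat_far (R : realType) (j k : nat) : j != k -> hat (j%:R - k%:R : R) = 0.
Proof.
move=> jk; rewrite /hat max_l// ge_min; case: (ltngtP j k) jk => // lt _.
  have : j.+1%:R <= k%:R :> R by rewrite ler_nat.
  by rewrite -natr1 => ?; apply/orP; right; lra.
have : k.+1%:R <= j%:R :> R by rewrite ler_nat.
by rewrite -natr1 => ?; apply/orP; left; lra.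
Qed.

Lemma sum_hat (R : realType) (n j : nat) (w : 'I_n -> R) (jn : (j < n)%N) :
  \sum_(k < n) w k * hat (j%:R - (k : nat)%:R) = w (Ordinal jn).
Proof.
rewrite (bigD1 (Ordinal jn))//= subrr hat0 mulr1 big1 ?addr0// => k kj.
rewrite hat_far ?mulr0//; apply: contraNneq kj => jk; apply/eqP/val_inj.
by rewrite /= jk.
Qed.

Lemma level_slope (R : realType) (n : nat) (w : 'I_n -> R) :
  (forall t, 1 <= w t) ->
  exists al : R -> R, [/\ cts al, forall y, 0 < al y &
    forall t : 'I_n, al ((t : nat)%:R + 2^-1) = w t].
Proof.
move=> w1; exists (fun y => 1 + \sum_(t < n) (w t - 1) * hat (y - 2^-1 - (t : nat)%:R)).
split.
- by cts_auto; apply: cts_hat; cts_auto.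
- move=> y; apply: ltr_wpDr => //; apply: sumr_ge0 => t _.
  by rewrite mulr_ge0 ?hat_ge0// subr_ge0.
- by move=> [t tn] /=; rewrite addrK (sum_hat (fun t => w t - 1) tn) addrC subrK.
Qed.

(** There is only one crossing per level.  The slope of the affine maps of the
    vertical lines can thus be a function of the level, equal at each crossing
    to the ratio w of the height differences of the two strands; w >= 1 makes it
    a sum of nonnegative bumps added to 1, hence positive. *)
Lemma braid_reheight (R : realType) (p m : nat) (c : nat -> option nat)
    (st : nat -> nat) (z z' : 'I_(p * turn_size m) -> R) :
  closed_braid p m c st ->
  (forall i j, braid_cross p m c st i j -> exists2 w : R, 1 <= w &
     midpoint z' i - midpoint z' j = w * (midpoint z i - midpoint z j)) ->
  isotopic (polygon (at_heights (braid_plan R p m c st) z))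
           (polygon (at_heights (braid_plan R p m c st) z')).
Proof.
move=> cb H; have sh := braid_shadow R cb.
have [w wP] : exists w : 'I_m -> R, forall t, 1 <= w t /\
    forall i j, braid_cross p m c st i j -> (i %% turn_size m = (3 * t).+1)%N ->
     midpoint z' i - midpoint z' j = w t * (midpoint z i - midpoint z j).
  suff h (t : 'I_m) : exists w : R, 1 <= w /\
    forall i j, braid_cross p m c st i j -> (i %% turn_size m = (3 * t).+1)%N ->
     midpoint z' i - midpoint z' j = w * (midpoint z i - midpoint z j).
    by have [w wP] := choice h; exists w.
  have [[i [j [cij it]]]|no] := pselect (exists i j,
      braid_cross p m c st i j /\ (i %% turn_size m = (3 * t).+1)%N); last first.
    by exists 1; split => // i j cij it; case: no; exists i, j.
  have [w w1 wE] := H _ _ cij; exists w; split => // i' j' cij' it'.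
  have [] := braid_cross_unique cb cij cij' _; first by rewrite it it'.
    by move=> [-> ->].
  by move=> [-> ->]; rewrite -opprB wE -mulrN opprB.
have [al [cal al0 alE]] := level_slope (fun t => proj1 (wP t)).
apply: (shadow_isotopy sh cal al0) => i j cij.
have [t [k [tm ct it jt h]]] := cij.
rewrite (proj2 (wP (Ordinal tm)) i j)//; congr (_ * _); rewrite -alE /=.
congr al; rewrite /midpoint braid_plan_ordS// /braid_plan it.
have := congr1 snd (@vpoint_strand R p m c (st (i %/ turn_size m)%N)
  (i %% turn_size m) 2^-1 _).
rewrite it => /(_ _)/= -> //; last by lia.
have -> : (3 * t).+1%:R = 3 * t%:R + 1 :> R by rewrite -natrM natr1.
by field.
Qed.

Definition cut_letters (T : nat) (c : nat -> option nat) (t : nat) : option nat :=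
  if (t < T)%N then c t else None.

Lemma posn_cut (T : nat) (c : nat -> option nat) (t k : nat) :
  posn (cut_letters T c) t k = posn c (minn t T) k.
Proof.
elim: t => [|t IH]; first by rewrite min0n.
rewrite posnS IH /cut_letters; have [tT|tT] := boolP (t < T)%N; last first.
  rewrite -leqNgt in tT; by rewrite (minn_idPr (leqW tT)) (minn_idPr tT).
by rewrite (minn_idPl tT) posnS (minn_idPl (ltnW tT)).
Qed.

Lemma closed_braid_cut (p m T : nat) (c : nat -> option nat) (st : nat -> nat) :
  closed_braid p m c st -> (T <= m)%N ->
  (forall k, (k < p)%N -> posn c m k = posn c T k) ->
  closed_braid p m (cut_letters T c) st.
Proof.
move=> cb Tm pure; split.
- exact: braid_gt0 cb.
- exact: strands_gt0 cb.
- move=> t i; rewrite /cut_letters; case: ifP => // _.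
  exact: (@braid_letter _ _ _ _ cb).
- exact: st_lt cb.
- exact: st_inj cb.
- by move=> a; rewrite (st_next cb) posn_cut (minn_idPr Tm) pure// (st_lt cb).
- exact: st_period cb.
Qed.

Lemma pl_lo (R : realType) (n : nat) (u : nat -> R) (y : R) :
  y <= 0 -> pl n u y = u 0%N.
Proof.
move=> y0; rewrite /pl big1 ?addr0// => i _; rewrite clamp_lo ?mulr0//.
by have : 0 <= i%:R :> R by []; lra.
Qed.

Lemma pl_hi (R : realType) (n : nat) (u : nat -> R) (y : R) :
  n%:R <= y -> pl n u y = u n.
Proof.
move=> ny; rewrite /pl -(big_mkord xpredT
  (fun j => (u j.+1 - u j) * clamp 0 1 (y - j%:R))).
rewrite (eq_big_nat _ _ (F2 := fun j => u j.+1 - u j)).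
  by rewrite telescope_sumr// addrC subrK.
move=> j /andP[_ ji]; rewrite clamp_hi ?mulr1//.
by have : (j.+1%:R <= n%:R :> R); [rewrite ler_nat|rewrite -natr1; lra].
Qed.

(** Below the level T the heights are those of the braid word; above it each
    strand runs at the constant height lay, and the closing arcs are under all
    layers. *)
Definition layered (R : realType) (m T : nat) (c : nat -> option nat)
    (sgn : nat -> bool) (lay : nat -> nat) (k l : nat) : R :=
  if (l < 3 * T)%N then bump_height R m c sgn k l
  else if (l <= 3 * m)%N then (lay k)%:R else 0.

Arguments layered R m T c sgn lay k l : clear implicits.

Lemma layered_turn (R : realType) (m T : nat) (c : nat -> option nat)
    (sgn : nat -> bool) (lay : nat -> nat) (k k' : nat) : (0 < T)%N -> (T <= m)%N ->
  layered R m T c sgn lay k (turn_size m) = layered R m T c sgn lay k' 0.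
Proof.
move=> T0 Tm; rewrite /layered /turn_size muln_gt0 T0 /bump_height mod0n andbF.
have -> : (3 * m + 5 < 3 * T)%N = false by apply/negbTE; lia.
by have -> : (3 * m + 5 <= 3 * m)%N = false by apply/negbTE; lia.
Qed.

(** The strands in the layers are pulled straight by a shear along the first
    axis: the height tells which strand a point belongs to, and the level how far
    it has to move. *)
Lemma straighten (R : realType) (p m T : nat) (c : nat -> option nat)
    (st : nat -> nat) (sgn : nat -> bool) (lay : nat -> nat) :
  closed_braid p m c st -> (0 < T)%N -> (T <= m)%N ->
  (forall k, (k < p)%N -> posn c m k = posn c T k) ->
  (forall k, (k < p)%N -> (0 < lay k)%N) ->
  (forall j k, (j < p)%N -> (k < p)%N -> lay j = lay k -> j = k) ->
  let z := turn_heights p m st (layered R m T c sgn lay) in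
  isotopic (polygon (at_heights (braid_plan R p m c st) z))
           (polygon (at_heights (braid_plan R p m (cut_letters T c) st) z)).
Proof.
move=> cb T0 Tm pure lay0 layI z.
have cb' := closed_braid_cut cb Tm pure.
pose u (k t : nat) : R := (posn c t k)%:R - (posn c (minn t T) k)%:R.
pose g (x : R * R) : R :=
  \sum_(k < p) pl m (u k) x.1 * hat (x.2 - (lay k)%:R).
have cg : cts g.
  rewrite /g; cts_auto; first by apply: (cts_comp (g := pl m _)); [exact: cts_pl|cts_auto].
  by apply: cts_hat; cts_auto.
have u0 k : u k 0%N = 0 by rewrite /u min0n subrr.
have um k : (k < p)%N -> u k m = 0.
  by move=> kp; rewrite /u (minn_idPr Tm) pure// subrr.
have g_lo y h : y <= 0 -> g (y, h) = 0.
  by move=> y0; rewrite /g big1// => k _; rewrite pl_lo// u0 mul0r.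
have g_hi y h : m%:R <= y -> g (y, h) = 0.
  by move=> ym; rewrite /g big1// => k _; rewrite pl_hi// um// mul0r.
have g_z0 y : g (y, 0) = 0.
  rewrite /g big1// => k _; rewrite -[0]/(0%:R) hat_far ?mulr0//.
  by rewrite eq_sym -lt0n lay0.
have g_lay k y : (k < p)%N -> g (y, (lay k)%:R) = pl m (u k) y.
  move=> kp; rewrite /g (bigD1 (Ordinal kp))//= subrr hat0 mulr1 big1 ?addr0//.
  move=> j jk; rewrite hat_far ?mulr0//; apply: contraNneq jk => /esym jk.
  by apply/eqP/val_inj/(layI _ _ (ltn_ord j) kp jk).
(* The displacement g vanishes on the closing arcs: they are at height 0, under
   all layers, or outside of the levels of the strands. *)
apply: (isotopic_shear_x cg).
have zS c' i (cb'' : closed_braid p m c' st) : z (ordS i) =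
    layered R m T c sgn lay (st (i %/ turn_size m)%N) (i %% turn_size m).+1.
  by rewrite /z (turn_heights_ordS _ cb'')// => k; exact: layered_turn.
have key i s : 0 <= s <= 1 ->
  let k := st (i %/ turn_size m)%N in let l := (i %% turn_size m)%N in
  let x := vpoint p m c k l s in
  let h := lin (layered R m T c sgn lay k l) (layered R m T c sgn lay k l.+1) s in
  (x.1 - g (x.2, h), x.2) = vpoint p m (cut_letters T c) k l s.
  move=> s01 k l x h; have kp : (k < p)%N by exact: st_lt cb _.
  have lL : (l < turn_size m)%N by rewrite ltn_mod turn_size_gt0.
  have [lm|ml] := ltnP l (3 * m).
    have [lT|Tl] := ltnP l (3 * T).
      rewrite (_ : g _ = 0) ?subr0.
        rewrite /x -surjective_pairing !vpoint_strand// !posn_cut.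
        have l1 : (l %/ 3 <= T)%N by lia.
        have l2 : ((l %/ 3).+1 <= T)%N by lia.
        by rewrite (minn_idPl l1) (minn_idPl l2).
      rewrite /g big1// => j _; rewrite [X in X * _](_ : _ = 0) ?mul0r//.
      rewrite /x vpoint_strand//=.
      have l3 : (l %/ 3 < m)%N by lia.
      have -> : (l%:R + s) / 3 = (l %/ 3)%:R + ((l %% 3)%:R + s) / 3 :> R.
        by rewrite {1}(divn_eq l 3) natrD natrM; field.
      rewrite plE//; last first.
        have : (l %% 3)%:R <= 2 :> R by rewrite ler_nat -ltnS ltn_mod.
        by have : 0 <= (l %% 3)%:R :> R by []; lra.
      have l1 : (l %/ 3 <= T)%N by lia.
      have l2 : ((l %/ 3).+1 <= T)%N by lia.
      by rewrite /u (minn_idPl l1) (minn_idPl l2) !subrr /lin !mulr0 addr0.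
    have hE : h = (lay k)%:R.
      rewrite /h /layered lm (ltnW lm).
      have -> : (l < 3 * T)%N = false by apply/negbTE; lia.
      have -> : (l.+1 < 3 * T)%N = false by apply/negbTE; lia.
      by rewrite /lin; ring.
    rewrite hE g_lay// /x !vpoint_strand// !posn_cut; cbn [fst snd].
    have l3 : (l %/ 3 < m)%N by lia.
    have -> : (l%:R + s) / 3 = (l %/ 3)%:R + ((l %% 3)%:R + s) / 3 :> R.
      by rewrite {1}(divn_eq l 3) natrD natrM; field.
    rewrite plE//; last first.
      have : (l %% 3)%:R <= 2 :> R by rewrite ler_nat -ltnS ltn_mod.
      by have : 0 <= (l %% 3)%:R :> R by []; lra.
    by congr pair; rewrite /u /lin; ring.
  have [j j5 lE] : exists2 j, (j < 5)%N & l = (3 * m + j)%N.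
    by exists (l - 3 * m)%N; move: lL; rewrite /turn_size; lia.
  have hE : (0 < j)%N -> h = 0.
    move=> j0; rewrite /h /layered lE.
    have -> : (3 * m + j < 3 * T)%N = false by apply/negbTE; lia.
    have -> : ((3 * m + j).+1 < 3 * T)%N = false by apply/negbTE; lia.
    have -> : (3 * m + j <= 3 * m)%N = false by apply/negbTE; lia.
    have -> : ((3 * m + j).+1 <= 3 * m)%N = false by apply/negbTE; lia.
    by rewrite /lin; ring.
  have xE : x = vpoint p m (cut_letters T c) k l s.
    rewrite /x lE !vpoint_arc// /arc_height !posn_cut (minn_idPr Tm) pure//.
  rewrite -xE (_ : g _ = 0) ?subr0 -?surjective_pairing//.
  case: j j5 lE hE => [|j] j5 lE hE; last by rewrite hE.
  apply: g_hi; rewrite /x lE vpoint_arc// /arc_point /= /lin.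
  have : 0 <= arc_height p m c k :> R by [].
  by have /andP[] := s01; nra.
apply/seteqP; split => [_ [_ [i [s s01 ->]] <-]|_ [i [s s01 ->]]].
  exists i, s => //; rewrite !segmentE /= !braid_plan_ordS// (zS c)//.
  have [e1 e2] := key i s s01.
  by rewrite -/(vpoint _ _ _ _ _ _) e1 e2.
exists ((1 - s) *: at_heights (braid_plan R p m c st) z i +
        s *: at_heights (braid_plan R p m c st) z (ordS i)); first by exists i, s.
rewrite !segmentE /= !braid_plan_ordS// (zS c)//.
have [e1 e2] := key i s s01.
by rewrite -/(vpoint _ _ _ _ _ _) e1 e2.
Qed.

Lemma nat_diff_sign (R : realType) (a b : nat) : a <> b ->
  exists2 w : R, 1 <= w & a%:R - b%:R = w * (if (b < a)%N then 1 else -1).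
Proof.
move=> ab; have [ba|] := ltnP b a.
  exists (a%:R - b%:R); last by ring.
  have : b.+1%:R <= a%:R :> R by rewrite ler_nat.
  by rewrite -natr1; lra.
rewrite leq_eqVlt => /orP[/eqP//|lt]; exists (b%:R - a%:R); last by ring.
have : a.+1%:R <= b%:R :> R by rewrite ler_nat.
by rewrite -natr1; lra.
Qed.

Lemma layered_midpoint (R : realType) (p m T : nat) (c c' : nat -> option nat)
    (st : nat -> nat) (sgn : nat -> bool) (lay : nat -> nat)
    (i : 'I_(p * turn_size m)) (t : nat) :
  closed_braid p m c st -> closed_braid p m c' st -> (0 < T)%N -> (T <= m)%N ->
  (t < m)%N -> (i %% turn_size m = (3 * t).+1)%N ->
  midpoint (turn_heights p m st (layered R m T c sgn lay)) i =
  if (t < T)%N then midpoint (turn_heights p m st (bump_height R m c sgn)) i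
  else (lay (st (i %/ turn_size m)%N))%:R.
Proof.
move=> cb cb' T0 Tm tm it; rewrite /midpoint (turn_heights_ordS _ cb'); last first.
  by move=> k; exact: layered_turn.
rewrite (turn_heights_ordS _ cb); last exact: bump_turn.
rewrite /turn_heights it /layered; have [tT|tT] := boolP (t < T)%N.
  have -> : ((3 * t).+1 < 3 * T)%N by lia.
  by have -> : ((3 * t).+2 < 3 * T)%N by lia.
have -> : ((3 * t).+1 < 3 * T)%N = false by apply/negbTE; lia.
have -> : ((3 * t).+2 < 3 * T)%N = false by apply/negbTE; lia.
have -> : ((3 * t).+1 <= 3 * m)%N by lia.
have -> : ((3 * t).+2 <= 3 * m)%N by lia.
by rewrite /lin; ring.
Qed.

(** The place of the i-th vertex of a closed polygon with n vertices, counted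
    from the vertex s. *)
Definition rank_from (n s i : nat) : nat := ((i + (n - s)) %% n)%N.

Lemma rank_from_inj (n s : nat) (i j : 'I_n) : (s < n)%N ->
  rank_from n s i = rank_from n s j -> i = j.
Proof.
move=> sn /eqP; rewrite /rank_from eqn_modDr !modn_small// => /eqP.
exact: val_inj.
Qed.

Lemma rank_from_ordS (n s : nat) (i : 'I_n) : (s < n)%N -> ordS i <> s :> nat ->
  rank_from n s (ordS i) = (rank_from n s i).+1.
Proof.
move=> sn Si; have n0 : (0 < n)%N by exact: leq_ltn_trans sn.
have e : rank_from n s (ordS i) = ((rank_from n s i).+1 %% n)%N.
  by rewrite /rank_from /= modnDml -[in RHS]addn1 modnDml addn1 addSn.
have : (rank_from n s i < n)%N by rewrite /rank_from ltn_pmod.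
rewrite leq_eqVlt => /orP[/eqP E|lt]; last by rewrite e modn_small.
case: Si; rewrite E modnn in e.
have := @rank_from_inj n s (ordS i) (Ordinal sn) sn.
rewrite e /rank_from /= subnKC ?modnn; last exact: ltnW.
by move=> /(_ erefl)/(congr1 (@nat_of_ord n)).
Qed.

(** The heights may first be changed so that the strands above the level T,
    which form a pure braid, lie in disjoint layers; they are pulled straight,
    after which the heights can be changed again, now into monotone ones. *)
Lemma layered_unknot (R : realType) (p m T : nat) (c : nat -> option nat)
    (st : nat -> nat) (sgn : nat -> bool) (lay : nat -> nat) (s : nat) (up : bool) :
  let n := (p * turn_size m)%N in
  closed_braid p m c st -> (0 < T)%N -> (T <= m)%N ->
  (forall k, (k < p)%N -> posn c m k = posn c T k) ->
  (forall k, (k < p)%N -> (0 < lay k)%N) ->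
  (forall j k, (j < p)%N -> (k < p)%N -> lay j = lay k -> j = k) ->
  (s < n)%N ->
  (forall (i : 'I_n) t, (t < m)%N -> ordS i = s :> nat ->
     (i %% turn_size m)%N <> (3 * t).+1) ->
  (forall i j t, braid_cross p m c st i j -> (i %% turn_size m = (3 * t).+1)%N ->
     c t = Some (posn c t (st (i %/ turn_size m)%N)) ->
     sgn t = if (T <= t)%N
       then (lay (st (j %/ turn_size m)%N) < lay (st (i %/ turn_size m)%N))%N
       else if up then (rank_from n s j < rank_from n s i)%N
       else (rank_from n s i < rank_from n s j)%N) ->
  unknot (polygon (braid_polygon R p m c st sgn)).
Proof.
move=> n cb T0 Tm pure lay0 layI sn base signs.
have cb' := closed_braid_cut cb Tm pure.
pose z0 := turn_heights p m st (bump_height R m c sgn).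
pose z1 := turn_heights p m st (layered R m T c sgn lay).
pose z2 (i : 'I_n) : R := (if up then 1 else -1) * (rank_from n s i)%:R.
have iso1 : isotopic (polygon (at_heights (braid_plan R p m c st) z0))
                     (polygon (at_heights (braid_plan R p m c st) z1)).
  apply: braid_reheight => // i j cij.
  have [t [tm it jt h]] := braid_crossP R sgn cb cij.
  rewrite /z1 (layered_midpoint _ _ _ cb cb T0 Tm tm it).
  rewrite (layered_midpoint _ _ _ cb cb T0 Tm tm jt).
  have [tT|Tt] := ltnP t T; first by exists 1; rewrite ?mul1r.
  have lay_neq : lay (st (i %/ turn_size m)%N) <> lay (st (j %/ turn_size m)%N).
    move=> /(layI _ _ (st_lt cb _) (st_lt cb _)).
    move=> /(st_inj cb (turn_lt i) (turn_lt j)) e.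
    by case: cij => ? [? [_ _ _ _ /= h']]; rewrite e in h'; lia.
  case: h => /= -[ct zi zj]; rewrite /z0 zi zj.
    have [w w1 wE] := nat_diff_sign R lay_neq.
    by exists w => //; rewrite wE subr0 (signs i j t cij it ct) Tt.
  have [w w1 wE] := nat_diff_sign R (nesym lay_neq).
  exists w => //; rewrite -opprB wE sub0r mulrN.
  by rewrite (signs j i t (cross_sym (braid_shadow R cb) cij) jt ct) Tt.
have iso2 : isotopic (polygon (at_heights (braid_plan R p m c st) z1))
    (polygon (at_heights (braid_plan R p m (cut_letters T c) st) z1)).
  exact: straighten.
have iso3 : isotopic
    (polygon (at_heights (braid_plan R p m (cut_letters T c) st) z1))
    (polygon (at_heights (braid_plan R p m (cut_letters T c) st) z2)).
  apply: braid_reheight => // i j cij'.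
  have cij : braid_cross p m c st i j.
    case: cij' => t [k [tm ct it jt h]]; exists t, k; move: ct h.
    rewrite /cut_letters; case: ifP => // tT ct; rewrite !posn_cut.
    by rewrite (minn_idPl (ltnW tT)) => h; split.
  have [t [tm it jt h]] := braid_crossP R sgn cb cij.
  have tT : (t < T)%N.
    case: cij' => t' [k [_ ct it' _ _]]; have -> : t = t' by lia.
    by move: ct; rewrite /cut_letters; case: ifP.
  rewrite /z1 (layered_midpoint _ _ _ cb cb' T0 Tm tm it).
  rewrite (layered_midpoint _ _ _ cb cb' T0 Tm tm jt) tT.
  have mid2 (x : 'I_n) : (x %% turn_size m = (3 * t).+1)%N -> midpoint z2 x =
      (if up then 1 else -1) * ((rank_from n s x)%:R + 2^-1).
    move=> xt; rewrite /midpoint /z2 rank_from_ordS//; last by move=> Sx; exact: (base x t tm Sx xt).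
    by rewrite -[(rank_from n s x).+1%:R]natr1 /lin; move: (if up then _ else _) => e; field.
  rewrite !mid2//.
  have neq : rank_from n s i <> rank_from n s j.
    move=> /(rank_from_inj sn) e.
    by case: cij => ? [? [_ _ _ _ /= h']]; rewrite e in h'; lia.
  have Tt : (T <= t)%N = false by rewrite leqNgt tT.
  have simp (e a b : R) : e * (a + 2^-1) - e * (b + 2^-1) = e * (a - b) by ring.
  rewrite simp.
  case: h => /= -[ct zi zj]; rewrite zi zj.
    have := signs i j t cij it ct; rewrite Tt => ->.
    case: (up).
      have [w w1 wE] := nat_diff_sign R neq.
      by exists w => //; rewrite mul1r wE subr0.
    have [w w1 wE] := nat_diff_sign R (nesym neq).
    by exists w => //; rewrite mulN1r opprB wE subr0.
  have := signs j i t (cross_sym (braid_shadow R cb) cij) jt ct; rewrite Tt => ->.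
  case: (up).
    have [w w1 wE] := nat_diff_sign R (nesym neq).
    by exists w => //; rewrite mul1r -opprB wE sub0r mulrN.
  have [w w1 wE] := nat_diff_sign R neq.
  by exists w => //; rewrite mulN1r wE sub0r mulrN.
apply: unknot_isotopic iso1 _; apply: unknot_isotopic iso2 _.
apply: unknot_isotopic iso3 _.
have sh := braid_shadow R cb'.
have asc : unknot (polygon (at_heights (braid_plan R p m (cut_letters T c) st)
    (fun i => (rank_from n s i)%:R))).
  apply: ascending_unknot => //; first exact: shadow_size sh.
  move=> x i t t' Sx ix t01 t01' e.
  have t01'' : 0 <= t' <= 1 by lra.
  case: (shadow_meet sh t01 t01'' e) => [[[xi _]|[_ _ t'0]|[_ _ t'1]]|[[u [k [um _ _ xu _]]] _ _]].
  - by rewrite xi eqxx in ix.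
  - by move: t01'; rewrite t'0; lra.
  - by move: t01'; rewrite t'1; lra.
  - exact: (base x u um Sx xu).
have z2E : z2 = if up then fun i => (rank_from n s i)%:R
                else fun i => - (rank_from n s i)%:R.
  by rewrite /z2; case: (up); apply/funext => i; rewrite ?mul1r ?mulN1r.
rewrite z2E; case: (up) => //.
apply: unknot_mirror; rewrite mirror_polygon.
by under [X in polygon X]funext do rewrite /mirror /at_heights /= opprK.
Qed.

(** * Weaving braids *)

Lemma weaving_cyclic_word (p q : nat) (p1 : (0 < p.-1)%N) :
  weaving_braid p q = cyclic_word p1 (q * p.-1) (fun t => ~~ odd (t %% p.-1)%N).
Proof.
rewrite /weaving_braid /cyclic_word; elim: q => [|q IH]; first by rewrite mul0n.
rewrite mulSn iotaD map_cat add0n /= IH; congr (_ ++ _).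
  rewrite -val_enum_ord -map_comp; apply: eq_map => i /=.
  have im : (i %% p.-1 = i)%N by rewrite modn_small.
  by congr pair; [apply/val_inj; rewrite /= im|rewrite im].
have -> : iota p.-1 (q * p.-1) = map (addn p.-1) (iota 0 (q * p.-1)).
  by rewrite -iotaDl addn0.
rewrite -map_comp; apply: eq_map => t /=.
by congr (_, _); [apply/val_inj|]; rewrite /= modnDl.
Qed.

(** In each period the strand in position 0 moves to the last position and all
    the others move one step to the left. *)
Lemma posn_cyclic (p j i k : nat) : (1 < p)%N -> (k < p)%N -> (i <= p.-1)%N ->
  posn (cyclic_letter p) (j * p.-1 + i) k =
  let x := ((k + j * p.-1) %% p)%N in
  if x == 0%N then i else if (x <= i)%N then x.-1 else x.
Proof.
move=> p1 kp.
have step : forall j, posn (cyclic_letter p) (j * p.-1) k = ((k + j * p.-1) %% p)%N ->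
  forall i, (i <= p.-1)%N -> posn (cyclic_letter p) (j * p.-1 + i) k =
  let x := ((k + j * p.-1) %% p)%N in
  if x == 0%N then i else if (x <= i)%N then x.-1 else x.
  move=> {}j e; elim=> [_|{}i IH ip].
    by rewrite addn0 e /= leqn0; case: eqP.
  rewrite addnS posnS IH ?(ltnW ip)// /cyclic_letter modnMDl modn_small//=.
  have : ((k + j * p.-1) %% p < p)%N by rewrite ltn_pmod// ltnW.
  move: ((k + j * p.-1) %% p)%N => x xp.
  case: (x =P 0%N) => [_|x0]; first by rewrite eqxx.
  case: (leqP x i) => xi.
    rewrite (leqW xi).
    case: (x.-1 =P i); [lia|move=> _].
    by case: (x.-1 =P i.+1); lia.
  case: (x =P i); [lia|move=> _].
  by case: (x =P i.+1) => [->|xi']; [rewrite leqnn|case: (leqP x i.+1); lia].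
have base : forall j, posn (cyclic_letter p) (j * p.-1) k = ((k + j * p.-1) %% p)%N.
  elim=> [|{}j IH]; first by rewrite mul0n addn0 modn_small.
  rewrite mulSnr step// addnA.
  have : ((k + j * p.-1) %% p < p)%N by rewrite ltn_pmod// ltnW.
  rewrite -[in RHS]modnDml; move: ((k + j * p.-1) %% p)%N => x xp /=.
  case: (x =P 0%N) => [->|x0]; first by rewrite add0n modn_small//; lia.
  have -> : (x <= p.-1)%N by lia.
  have -> : (x + p.-1 = x.-1 + p)%N by lia.
  by rewrite modnDr modn_small//; lia.
exact: step.
Qed.

Lemma posn_cyclic_period (p j k : nat) : (1 < p)%N -> (k < p)%N ->
  posn (cyclic_letter p) (j * p.-1) k = ((k + j * p.-1) %% p)%N.
Proof.
move=> p1 kp; rewrite -[(j * p.-1)%N in LHS]addn0 posn_cyclic//= leqn0.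
by case: eqP.
Qed.

Lemma position_origin (p j k e : nat) : (1 < p)%N -> (k < p)%N ->
  ((k + j * p.-1) %% p = e)%N -> k = ((j + e) %% p)%N.
Proof.
move=> p1 kp <-; rewrite modnDmr addnCA -mulnS prednK ?(ltnW p1)//.
by rewrite addnC modnMDl modn_small.
Qed.

Lemma cyclic_crossing (p j i k k' : nat) : (1 < p)%N -> (k < p)%N -> (k' < p)%N ->
  (i < p.-1)%N ->
  posn (cyclic_letter p) (j * p.-1 + i) k = i ->
  posn (cyclic_letter p) (j * p.-1 + i) k' = i.+1 ->
  k = (j %% p)%N /\ k' = ((j + i.+1) %% p)%N.
Proof.
move=> p1 kp kp' ip; rewrite !posn_cyclic ?(ltnW ip)//=.
move=> e e'; split.
  rewrite -[in RHS](addn0 j); apply: position_origin => //.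
  move: e; case: eqP => // x0; case: leqP; lia.
apply: position_origin => //; move: e'; case: eqP => [|x0]; first by lia.
case: leqP; lia.
Qed.

Definition weaving_start (p m a : nat) : nat := ((a * m) %% p)%N.

Lemma weaving_closed_braid (p q : nat) : (1 < p)%N -> (0 < q)%N -> coprime p q ->
  closed_braid p (q * p.-1) (cyclic_letter p) (weaving_start p (q * p.-1)).
Proof.
move=> p1 q0 pq; have p0 : (0 < p)%N := ltnW p1.
have pp : (0 < p.-1)%N by lia.
split => //.
- by rewrite muln_gt0 q0.
- by move=> t i [<-]; have := ltn_pmod t pp; lia.
- by move=> a; rewrite /weaving_start ltn_pmod.
- move=> a b ap bp; have cop : coprime (q * p.-1) p.
    by rewrite coprimeMl coprime_sym pq /= coprimePn.
  move=> /eqP; rewrite /weaving_start.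
  wlog ab : a b ap bp / (b <= a)%N.
    by move=> H; case: (leqP b a) => [|/ltnW] ab e; [|symmetry]; apply: H => //; rewrite eq_sym.
  rewrite eqn_mod_dvd ?leq_mul2r ?ab ?orbT// -mulnBl.
  rewrite Gauss_dvdl; last by rewrite coprime_sym.
  case: (posnP (a - b)%N) => [|ab0 /(dvdn_leq ab0)]; lia.
- move=> a; rewrite posn_cyclic_period ?ltn_pmod//.
  by rewrite /weaving_start mulSn addnC modnDml.
- by rewrite /weaving_start mul0n mod0n modnMr.
Qed.

(** * Counting crossing changes *)

Section Counting.
Local Open Scope nat_scope.

Lemma sum_nat_mul (a b : nat) (F : nat -> nat) :
  \sum_(0 <= t < a * b) F t = \sum_(0 <= j < a) \sum_(0 <= i < b) F (j * b + i)%N.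
Proof.
elim: a => [|a IH]; first by rewrite mul0n !big_nil.
rewrite big_nat_recr//= -IH mulSnr (big_cat_nat (leq0n _) (leq_addr _ _)) /=.
congr addn; rewrite -{1}[(a * b)%N]add0n big_addn addKn.
by apply: eq_bigr => i _; rewrite addnC.
Qed.

Lemma sum_nat_reindex (n : nat) (f : nat -> nat) (F : nat -> nat) :
  (forall a, (a < n)%N -> (f a < n)%N) ->
  (forall a b, (a < n)%N -> (b < n)%N -> f a = f b -> a = b) ->
  \sum_(0 <= x < n) F (f x) = \sum_(0 <= x < n) F x.
Proof.
move=> flt finj; rewrite !big_mkord.
pose g (i : 'I_n) := Ordinal (flt i (ltn_ord i)).
have ginj : injective g by move=> i j [] /finj ij; apply/val_inj/ij.
by rewrite [RHS](reindex g)//; apply: onW_bij; exact: injF_bij.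
Qed.

Lemma count_above (p f : nat) : (f <= p)%N ->
  \sum_(0 <= x < p) (p <= x + f)%N = f.
Proof.
move=> fp; rewrite (big_cat_nat (leq0n (p - f)) (leq_subr _ _)) /=.
rewrite big_nat big1 => [|x /andP[_ xf]]; last first.
  by apply/eqP; rewrite eqb0 -ltnNge; lia.
rewrite (eq_big_nat _ _ (F2 := fun=> 1%N)) => [|x /andP[xf _]].
  by rewrite sum_nat_const_nat muln1 add0n subKn.
by apply/eqP; rewrite eqb1; lia.
Qed.

Lemma count_below (p f : nat) : (f <= p)%N -> \sum_(0 <= x < p) (x < f)%N = f.
Proof.
move=> fp; rewrite (big_cat_nat (leq0n f) fp) /=.
rewrite (eq_big_nat _ _ (F2 := fun=> 1%N)) => [|x /andP[_ xf]]; last by rewrite xf.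
rewrite sum_nat_const_nat muln1 subn0 big_nat big1 ?addn0// => x /andP[xf _].
by apply/eqP; rewrite eqb0 -leqNgt.
Qed.

(** The layer of the strand of position k in a block of p periods.  In the
    alternating block the strand k passes over both crossings with the strand
    k + d (mod p) when d is odd; as -2 (p - 1)/2 = 1 (mod p), these are the p
    points on a circle, each beating the (p - 1)/2 following ones, if k is put
    at the place k (p - 1)/2. *)
Definition layer (p k : nat) : nat := (p - (k * p.-1./2) %% p)%N.

Definition block_sign (p j i : nat) : bool :=
  (layer p ((j + i.+1) %% p) < layer p (j %% p))%N.

Lemma odd_pred (p : nat) : odd p -> p.-1 = (p.-1./2 * 2)%N /\ p = (p.-1./2 * 2).+1.
Proof. by move=> op; have := odd_double_half p.-1; case: p op => //= p /negbTE ->; lia. Qed.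

Lemma coprime_half (p : nat) : odd p -> coprime p p.-1./2.
Proof.
move=> op; have [_ pE] := odd_pred op; rewrite {1}pE.
by rewrite -addn1 mulnC coprime_sym /coprime gcdnMDl gcdn1.
Qed.

Lemma half_mul_inj (p j k : nat) : odd p -> (j < p)%N -> (k < p)%N ->
  ((j * p.-1./2) %% p = (k * p.-1./2) %% p)%N -> j = k.
Proof.
move=> op; wlog jk : j k / (k <= j)%N.
  by move=> H jp kp e; case: (leqP k j) => [|/ltnW] kj; [|symmetry]; apply: H.
move=> jp kp /eqP; rewrite eqn_mod_dvd ?leq_mul2r ?jk ?orbT// -mulnBl.
rewrite Gauss_dvdl ?coprime_half//.
by case: (posnP (j - k)%N) => [|jk0 /(dvdn_leq jk0)]; lia.
Qed.

Lemma layer_gt0 (p k : nat) : (0 < p)%N -> (0 < layer p k)%N.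
Proof. by move=> p0; rewrite subn_gt0 ltn_pmod. Qed.

Lemma layer_inj (p j k : nat) : odd p -> (j < p)%N -> (k < p)%N ->
  layer p j = layer p k -> j = k.
Proof.
move=> op jp kp e; apply: (half_mul_inj op jp kp).
have p0 : (0 < p)%N by exact: leq_ltn_trans jp.
have := ltn_pmod (j * p.-1./2) p0; have := ltn_pmod (k * p.-1./2) p0.
by move: e; rewrite /layer; lia.
Qed.

(** The layers are wrong for the two crossings of the pairs of strands whose arc
    on the circle contains the cut.  With h = (p - 1)/2, the letters 2 e and
    2 e + 1 of a period join strands at distances h - e and e + 1 on the circle,
    so there are (h - e) + (e + 1) wrong crossings at these letters. *)
Lemma block_count (p : nat) : odd p ->
  \sum_(0 <= j < p) \sum_(0 <= i < p.-1) (~~ odd i != block_sign p j i) =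
  (p.-1./2 * p.-1./2.+1)%N.
Proof.
move=> op; have [hE pE] := odd_pred op; set h := p.-1./2 in hE pE *.
have p0 : (0 < p)%N by rewrite pE.
have sgnE j i : (j < p)%N -> block_sign p j i =
    ((j * h) %% p < ((j * h) %% p + i.+1 * h) %% p)%N.
  move=> jp; rewrite /block_sign /layer -/h !modnMml mulnDl modnDml.
  have := ltn_pmod (j * h) p0; have := ltn_pmod (j * h + i.+1 * h) p0; lia.
rewrite exchange_big /=.
have colE i : (i < p.-1)%N ->
    \sum_(0 <= j < p) (~~ odd i != block_sign p j i) =
    \sum_(0 <= x < p) (~~ odd i != (x < (x + i.+1 * h) %% p)%N).
  move=> ip; rewrite -[RHS](sum_nat_reindex (f := fun j => (j * h %% p)%N)).
  - by apply: eq_big_nat => j /andP[_ jp]; rewrite sgnE.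
  - by move=> a _; rewrite ltn_pmod.
  - by move=> a b; exact: half_mul_inj.
rewrite (eq_big_nat _ _ (F2 := fun i =>
  \sum_(0 <= x < p) (~~ odd i != (x < (x + i.+1 * h) %% p)%N))); last first.
  by move=> i /andP[_ ip]; exact: colE.
rewrite hE sum_nat_mul.
rewrite (eq_big_nat _ _ (F2 := fun=> h.+1)).
  by rewrite sum_nat_const_nat subn0.
move=> e /andP[_ eh]; rewrite !big_nat_recr//= big_nil add0n addn0.
have even0 : odd (e * 2) = false by rewrite oddM andbF.
rewrite addn1 /= even0 /=.
rewrite (eq_big_nat _ _ (F2 := fun x => nat_of_bool (p <= x + (h - e))%N)); last first.
  move=> x /andP[_ xp]; congr nat_of_bool.
  (* As 2 h = -1 (mod p), adding (2 e + 1) h amounts to adding h - e. *)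
  have -> : (x + (e * 2).+1 * h = e * p + (x + (h - e)))%N by rewrite pE; nia.
  rewrite modnMDl; have [ge|lt] := leqP p (x + (h - e)).
    have -> : (x + (h - e) = x + (h - e) - p + p)%N by lia.
    rewrite modnDr modn_small; last by lia.
    by have -> : (x < x + (h - e) - p)%N = false by apply/negbTE; lia.
  rewrite modn_small//.
  by have -> : (x < x + (h - e))%N by lia.
rewrite count_above; last by lia.
rewrite (eq_big_nat _ _ (F2 := fun x => nat_of_bool (x < e.+1)%N)); last first.
  move=> x /andP[_ xp]; congr nat_of_bool.
  have -> : (x + (e * 2).+2 * h = e * p + (x + (p - e.+1)))%N by rewrite pE; nia.
  rewrite modnMDl; have [lt|ge] := ltnP x e.+1.
    rewrite modn_small; last by lia.
    by have -> : (x < x + (p - e.+1))%N by lia.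
  have -> : (x + (p - e.+1) = x - e.+1 + p)%N by lia.
  rewrite modnDr modn_small; last by lia.
  by have -> : (x < x - e.+1)%N = false by apply/negbTE; lia.
rewrite count_below; lia.
Qed.

Lemma blocks_count (p n r : nat) : odd p ->
  \sum_(0 <= t < n * p * p.-1)
    (~~ odd (t %% p.-1) != block_sign p (r + t %/ p.-1) (t %% p.-1)) =
  (n * (p.-1./2 * p.-1./2.+1))%N.
Proof.
move=> op; have p0 : (0 < p)%N by case: p op.
rewrite sum_nat_mul.
rewrite (eq_big_nat _ _ (F2 := fun j =>
  \sum_(0 <= i < p.-1) (~~ odd i != block_sign p (r + j) i))); last first.
  move=> j _; apply: eq_big_nat => i /andP[_ ip].
  by rewrite modnMDl modn_small// divnMDl ?(leq_ltn_trans _ ip)// divn_small// addn0.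
rewrite sum_nat_mul (eq_big_nat _ _ (F2 := fun=> (p.-1./2 * p.-1./2.+1)%N)).
  by rewrite sum_nat_const_nat subn0.
move=> b _; rewrite -(block_count op).
rewrite -[RHS](sum_nat_reindex (f := fun x => ((r + x) %% p)%N)).
- apply: eq_bigr => x _; apply: eq_bigr => i _; congr (nat_of_bool (_ != _)).
  rewrite /block_sign modn_mod modnDml.
  by rewrite addnCA modnMDl -addnA modnMDl.
- by move=> a _; rewrite ltn_pmod.
- move=> x y xp yp /eqP; rewrite eqn_modDl !modn_small// => /eqP //.
Qed.

End Counting.

(** * The monotone diagram of the remaining periods *)

(** The inverse of weaving_start. *)
Definition turn_of (p m k : nat) : nat :=
  index k [seq weaving_start p m a | a <- iota 0 p].

(** The sign making the knot increasing from vertex 3 on if up holds, and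
    decreasing from vertex 0 on otherwise; vertex 3 ends the first level, whose
    crossing lies on the edge from vertex 1 to vertex 2. *)
Definition turn_sign (p m : nat) (up : bool) (t : nat) : bool :=
  let rank k := rank_from (p * turn_size m) (if up then 3 else 0)%N
    (turn_of p m k * turn_size m + (3 * t).+1) in
  let a := ((t %/ p.-1) %% p)%N in
  let b := ((t %/ p.-1 + (t %% p.-1).+1) %% p)%N in
  if up then (rank b < rank a)%N else (rank a < rank b)%N.

Arguments turn_sign p m up t : simpl never.

Lemma turn_ofK (p q a : nat) : (1 < p)%N -> (0 < q)%N -> coprime p q -> (a < p)%N ->
  turn_of p (q * p.-1) (weaving_start p (q * p.-1) a) = a.
Proof.
move=> p1 q0 pq ap; have cb := weaving_closed_braid p1 q0 pq.
rewrite /turn_of; set S := map _ _.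
have -> : weaving_start p (q * p.-1) a = nth 0%N S a.
  by rewrite (nth_map 0%N) ?size_iota// nth_iota.
rewrite index_uniq ?size_map ?size_iota//.
rewrite map_inj_in_uniq ?iota_uniq// => x y; rewrite !mem_iota add0n /= => xp yp.
exact: (st_inj cb).
Qed.

Lemma turn_ofP (p q k : nat) : (1 < p)%N -> (0 < q)%N -> coprime p q -> (k < p)%N ->
  exists2 a, (a < p)%N & turn_of p (q * p.-1) k = a /\ weaving_start p (q * p.-1) a = k.
Proof.
move=> p1 q0 pq kp; have cb := weaving_closed_braid p1 q0 pq.
have [a ap /= ak] := closed_braid_surj 0 cb kp.
by exists a => //; split => //; rewrite -ak turn_ofK.
Qed.

(** Moving the starting point from vertex 0 to vertex 3 passes the first crossing
    only, so that it preserves the order of the two strands at all others. *)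
Lemma turn_sign_opposite (p q t : nat) : (1 < p)%N -> (0 < q)%N -> coprime p q ->
  (0 < t)%N -> (t < q * p.-1)%N ->
  turn_sign p (q * p.-1) true t = ~~ turn_sign p (q * p.-1) false t.
Proof.
move=> p1 q0 pq t0 tm; rewrite /turn_sign; set m := (q * p.-1)%N in tm *.
have p0 : (0 < p)%N by exact: ltnW.
set a := ((t %/ p.-1) %% p)%N; set b := ((t %/ p.-1 + _) %% p)%N.
have ap : (a < p)%N by rewrite ltn_pmod.
have bp : (b < p)%N by rewrite ltn_pmod.
have ab : a <> b.
  move=> e; have : (t %/ p.-1 + 0 == t %/ p.-1 + (t %% p.-1).+1 %[mod p])%N.
    by rewrite addn0; apply/eqP.
  have : (t %% p.-1 < p.-1)%N by rewrite ltn_pmod//; lia.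
  by move=> ?; rewrite eqn_modDl mod0n modn_small; lia.
have [x xp [xa ax]] := turn_ofP p1 q0 pq ap.
have [y yp [yb bby]] := turn_ofP p1 q0 pq bp.
rewrite -/m in xa yb; rewrite xa yb.
have xy : x <> y by move=> e; apply: ab; rewrite -ax -bby e.
have small z : (z < p)%N -> (z * turn_size m + (3 * t).+1 < p * turn_size m)%N.
  by move=> zp; apply: index_lt => //; rewrite /turn_size; lia.
have := small x xp; have := small y yp; rewrite /rank_from.
set u := (x * _ + _)%N; set v := (y * _ + _)%N => vN uN.
have uv : u <> v.
  move=> /eqP; rewrite /u /v eqn_add2r eqn_pmul2r ?turn_size_gt0//.
  by move=> /eqP.
have u4 : (3 < u)%N by rewrite /u; lia.
have v4 : (3 < v)%N by rewrite /v; lia.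
set M := (p * _)%N in vN uN *.
have r3 w : (3 < w)%N -> (w < M)%N -> ((w + (M - 3)) %% M = w - 3)%N.
  move=> w3 wM; have -> : (w + (M - 3) = w - 3 + M)%N by lia.
  by rewrite modnDr modn_small//; lia.
have r0 w : (w < M)%N -> ((w + (M - 0)) %% M = w)%N.
  by move=> wM; rewrite subn0 modnDr modn_small.
by rewrite !r3// !r0//; lia.
Qed.

(** A decreasing knot meets the first crossing first from above; an increasing
    knot that starts just behind this crossing meets it last from above. *)
Lemma turn_sign0 (p q : nat) (up : bool) : (2 < p)%N -> (0 < q)%N -> coprime p q ->
  turn_sign p (q * p.-1) up 0 = true.
Proof.
move=> p2 q0 pq; rewrite /turn_sign div0n !mod0n add0n modn_small; last by lia.
have p1 : (1 < p)%N by lia.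
have p0 : (0 < p)%N by lia.
set m := (q * p.-1)%N.
have m2 : (2 <= m)%N.
  by rewrite /m (leq_trans _ (leq_pmull _ q0))//; lia.
have t0 : turn_of p m 0 = 0%N.
  by have := turn_ofK p1 q0 pq p0; rewrite /weaving_start mul0n mod0n.
have [y yp [yb y1]] := turn_ofP p1 q0 pq p1.
rewrite -/m in yb; rewrite t0 yb mul0n add0n muln0.
have y0 : (0 < y)%N by case: y y1 {yp yb}; rewrite // /weaving_start mul0n mod0n.
have L11 : (11 <= turn_size m)%N by rewrite /turn_size; lia.
have L1 : (1 < turn_size m)%N by lia.
have yN := index_lt yp L1.
have Ly : (turn_size m <= y * turn_size m)%N by rewrite leq_pmull.
move: yN Ly; rewrite /rank_from; set M := (p * _)%N; set v := (y * _)%N => vM Lv.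
case: up; last by rewrite subn0 !modnDr !modn_small; lia.
have -> : (v + 1 + (M - 3) = v - 2 + M)%N by lia.
by rewrite modnDr !modn_small; lia.
Qed.

(** Apart from the first crossing, which needs no change, the two sets of changes
    are complementary; the smaller one is at most half of the odd number
    r (p - 1) - 1. *)
Lemma turn_sign_count (p q r : nat) : odd p -> (2 < p)%N -> (0 < r)%N -> (r <= q)%N ->
  coprime p q -> exists up : bool,
  (\sum_(0 <= t < r * p.-1) (~~ odd (t %% p.-1) != turn_sign p (q * p.-1) up t) <=
   r * p.-1./2 - 1)%N.
Proof.
move=> op p2 r0 rq pq; have q0 : (0 < q)%N by exact: leq_trans rq.
have p1 : (1 < p)%N by lia.
have [hE _] := odd_pred op.
pose S up := (\sum_(0 <= t < r * p.-1)
  (~~ odd (t %% p.-1) != turn_sign p (q * p.-1) up t))%N.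
have SS : (S true + S false = r * p.-1 - 1)%N.
  have T0 : (0 < r * p.-1)%N by rewrite muln_gt0 r0; lia.
  rewrite /S -big_split /= big_ltn// !turn_sign0// mod0n /= addn0 add0n.
  rewrite (eq_big_nat _ _ (F2 := fun=> 1%N)).
    by rewrite sum_nat_const_nat muln1.
  move=> t /andP[t0 tT]; rewrite turn_sign_opposite//; last first.
    by apply: (leq_trans tT); rewrite leq_mul2r rq orbT.
  by case: (odd _); case: (turn_sign _ _ _ _).
have T2 : (r * p.-1 = r * p.-1./2 * 2)%N by rewrite {1}hE mulnA.
have h0 : (0 < r * p.-1./2)%N by rewrite muln_gt0 r0; lia.
rewrite T2 in SS; case: (leqP (S true) (r * p.-1./2 - 1)) => [le|lt].
  by exists true.
by exists false; rewrite -/(S false); lia.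
Qed.

Definition final_sign (p q r : nat) (up : bool) (t : nat) : bool :=
  if (r * p.-1 <= t)%N then block_sign p (t %/ p.-1) (t %% p.-1)
  else turn_sign p (q * p.-1) up t.

Lemma final_sign_unknot (R : realType) (p n r : nat) (up : bool) :
  odd p -> (2 < p)%N -> (0 < r)%N -> coprime p (n * p + r) ->
  let m := ((n * p + r) * p.-1)%N in
  unknot (polygon (braid_polygon R p m (cyclic_letter p) (weaving_start p m)
    (final_sign p (n * p + r) r up))).
Proof.
move=> op p2 r0 pq m; have p1 : (1 < p)%N by lia.
have p0 : (0 < p)%N by lia.
have pp : (0 < p.-1)%N by lia.
have q0 : (0 < n * p + r)%N by rewrite addn_gt0 r0 orbT.
have cb := weaving_closed_braid p1 q0 pq; rewrite -/m in cb.
have m2 : (2 <= m)%N by rewrite /m (leq_trans _ (leq_pmull _ q0))//; lia.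
have L11 : (11 <= turn_size m)%N by rewrite /turn_size; lia.
have LN : (turn_size m <= p * turn_size m)%N by rewrite leq_pmull.
apply: (@layered_unknot R p m (r * p.-1)%N (cyclic_letter p) (weaving_start p m)
  _ (layer p) (if up then 3 else 0)%N up) => //.
- by rewrite muln_gt0 r0.
- by rewrite /m leq_mul2r leq_addl orbT.
- move=> k kp; rewrite !posn_cyclic_period//.
  by rewrite mulnDl mulnAC addnCA modnMDl.
- by move=> k _; exact: layer_gt0.
- by move=> j k; exact: layer_inj.
- by case: up; lia.
- move=> i t tm /= Si it; have ip := ltn_ord i.
  have L3 : ((3 * t).+2 < turn_size m)%N by rewrite /turn_size; lia.
  have iS : i.+1 = (i %/ turn_size m * turn_size m + (3 * t).+2)%N.
    by rewrite {1}(divn_eq i (turn_size m)) it; lia.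
  have [iN|iN] := ltnP i.+1 (p * turn_size m).
    rewrite modn_small// in Si; case: (up) Si => Si //.
    have i2 : nat_of_ord i = 2%N by lia.
    by move: it; rewrite i2 modn_small; lia.
  have iE : i.+1 = (p * turn_size m)%N by apply/eqP; rewrite eqn_leq ip.
  have := congr1 (modn^~ (turn_size m)) iS.
  by rewrite /= iE modnMl modnMDl modn_small.
move=> i j t cij it ct.
have [t' [k [tm ct' it' jt h]]] := cij.
have tt : t' = t by lia.
rewrite {}tt in tm ct' it' jt h.
move: ct; rewrite ct' => -[kE]; have kt : k = (t %% p.-1)%N by case: ct'.
have yE : posn (cyclic_letter p) t (weaving_start p m (j %/ turn_size m)%N) = k.+1.
  by case: h => /= -[] //; rewrite -kE; lia.
have [ai aj] : weaving_start p m (i %/ turn_size m)%N = ((t %/ p.-1) %% p)%N /\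
    weaving_start p m (j %/ turn_size m)%N =
    ((t %/ p.-1 + (t %% p.-1).+1) %% p)%N.
  apply: cyclic_crossing; rewrite ?(st_lt cb) ?ltn_pmod// -divn_eq -kt//.
have vE (x : 'I_(p * turn_size m)) : (x %% turn_size m = (3 * t).+1)%N ->
    (turn_of p m (weaving_start p m (x %/ turn_size m)%N) * turn_size m +
     (3 * t).+1)%N = x.
  by move=> xt; rewrite turn_ofK ?turn_lt// -xt -divn_eq.
rewrite /final_sign /block_sign /turn_sign; case: ifP => _; first by rewrite -ai -aj.
by rewrite -ai -aj !vE.
Qed.

Lemma weaving_unknotted_by (R : realType) (p n r : nat) :
  odd p -> (2 < p)%N -> (0 < r)%N -> coprime p r ->
  exists2 k, (k <= n * (p.-1./2 * p.-1./2.+1) + (r * p.-1./2 - 1))%N &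
    unknotted_by k (weaving_knot R p (n * p + r)).
Proof.
move=> op p2 r0 pr; have p1 : (1 < p)%N by lia.
have pp : (0 < p.-1)%N by lia.
have q0 : (0 < n * p + r)%N by rewrite addn_gt0 r0 orbT.
have pq : coprime p (n * p + r) by rewrite /coprime gcdnMDl.
have [up count] := turn_sign_count op p2 r0 (leq_addl (n * p) r) pq.
set q := (n * p + r)%N in q0 pq count *.
have cb := weaving_closed_braid p1 q0 pq.
rewrite /weaving_knot (weaving_cyclic_word q pp) (braid_closure_polygon R pp _ cb).
have letters t : (t < q * p.-1)%N -> cyclic_letter p t <> None by [].
have triv := unknot_trivial (@final_sign_unknot R p n r up op p2 r0 pq).
have := unknotted_by_flips (fun t => ~~ odd (t %% p.-1)) cb letters triv.
set D := #|_|; exists D => //.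
have -> : D = (\sum_(0 <= t < q * p.-1)
    (~~ odd (t %% p.-1) != final_sign p q r up t))%N.
  rewrite /D -sum1dep_card big_mkcond big_mkord /=.
  by apply: eq_bigr => t _; case: (_ != _).
have Tm : (r * p.-1 <= q * p.-1)%N by rewrite leq_mul2r leq_addl orbT.
rewrite (big_cat_nat (leq0n _) Tm) /= addnC leq_add//; last first.
  apply: leq_trans count; apply/eq_leq/eq_big_nat => t /andP[_ tT].
  by rewrite /final_sign leqNgt tT.
rewrite -(blocks_count n r op) -{1}[(r * p.-1)%N]add0n big_addn.
rewrite -mulnBl addnK; apply/eq_leq/eq_big_nat => t _.
rewrite /final_sign leq_addl [(t + _)%N]addnC modnMDl divnMDl//.
Qed.

Theorem theorem1p1 (R : realType) (p n r : nat)
    (p_odd : odd p) (p_ge3 : (3 <= p)%N)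
    (r_ge1 : (1 <= r)%N) (r_lep : (r <= p - 1)%N)
    (coprime_pr : gcdn p r = 1%N) (q_ge2 : (2 <= n * p + r)%N) :
  (unknotting_number (weaving_knot R p (n * p + r)) <=
   (n%:R * (p%:R ^+ 2 - 1) / 4 + (p%:R - 1) * r%:R / 2 - 1)%:E)%E.
Proof.
have cop : coprime p r by apply/eqP.
have [k kK ku] := weaving_unknotted_by R n p_odd p_ge3 r_ge1 cop.
apply: (@le_trans _ _ (k%:R%:E)).
  by apply: ereal_inf_lbound; exists k.
rewrite lee_fin; have [hE pE] := odd_pred p_odd.
set h := p.-1./2 in hE pE kK.
have h0 : (0 < r * h)%N by rewrite muln_gt0 r_ge1; lia.
have : k%:R <= (n * (h * h.+1) + (r * h - 1))%:R :> R by rewrite ler_nat.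
rewrite natrD natrB// !natrM -natr1.
have -> : p%:R = 2 * h%:R + 1 :> R by rewrite pE -natr1 natrM mulrC.
by lra.
Qed.
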